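(* Let $(M^1,\nabla^1,h^1)$ and $(M^2,\nabla^2,h^2)$ be two K-V manifolds, let $\Pi^i$ be the associated Poisson bivector field on $TM^i$ ($i=1,2$), and let $F:M^1\to M^2$ be an affine map. Then the following assertions are equivalent: (i) $F$ is a K-V map, i.e. for all $\alpha,\beta\in\Omega^1(M^2)$, $h^1(F^*\alpha,F^*\beta)=h^2(\alpha,\beta)\circ F$. (ii) The tangent map $TF:(TM^1,\Pi^1)\to(TM^2,\Pi^2)$ is a Poisson map. (iii) For any one-form $\alpha\in\Omega^1(M^2)$, the vector fields $(F^*\alpha)^{\#_1}\in\Gamma(TM^1)$ and $\alpha^{\#_2}\in\Gamma(TM^2)$ are $F$-related. (iv) For any $f\in C^\infty(M^2)$, the K-V Hamiltonian vector fields $X_{f}\in\Gamma(TM^2)$ and $X_{f\circ F}\in\Gamma(TM^1)$ are $F$-related.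
   Context: An affine manifold $(M,\nabla)$ is a manifold with a flat torsion-free connection $\nabla$ on $TM$. For a symmetric bivector field $h$ on $M$ (symmetric section of $TM\otimes TM$), let $h_\#:T^*M\to TM$, $\alpha\mapsto\alpha^\#$, be defined by $\beta(\alpha^\#)=h(\alpha,\beta)$. The triple $(M,\nabla,h)$ is a Koszul-Vinberg (K-V) manifold if $(\nabla_{\alpha^\#}h)(\beta,\gamma)=(\nabla_{\beta^\#}h)(\alpha,\gamma)$ for all $\alpha,\beta,\gamma\in\Omega^1(M)$. For $f\in C^\infty(M)$ the K-V Hamiltonian vector field is $X_f=(df)^\#$. The symbol $\#_i$ denotes the map $\#$ for $h^i$. Let $p:TM\to M$ be the projection. The connection $\nabla$ splits $TTM$ into vertical and horizontal subbundles; for $X\in\Gamma(TM)$, $X^v$ and $X^h$ denote the vertical and horizontal lifts. For $\alpha\in\Omega^1(M)$, the one-forms $\alpha^v,\alpha^h\in\Omega^1(TM)$ are defined by $\alpha^v(X^v)=\alpha(X)\circ p$, $\alpha^v(X^h)=0$, $\alpha^h(X^h)=\alpha(X)\circ p$, $\alpha^h(X^v)=0$. The bivector field $\Pi$ on $TM$ associated to $(\nabla,h)$ is the skew-symmetric one given by $\Pi(\alpha^v,\beta^v)=\Pi(\alpha^h,\beta^h)=0$ and $\Pi(\alpha^h,\beta^v)=-\Pi(\beta^v,\alpha^h)=h(\alpha,\beta)\circ p$. It is known that $\Pi$ is Poisson if and only if $(M,\nabla,h)$ is a K-V manifold. Vector fields $X\in\Gamma(TM^1)$, $Y\in\Gamma(TM^2)$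 are $F$-related if $T_xF(X_x)=Y_{F(x)}$ for all $x\in M^1$. A smooth map $F:(M^1,\nabla^1)\to(M^2,\nabla^2)$ is affine if it maps vector fields parallel along a curve $\gamma$ to vector fields parallel along $F\circ\gamma$ (equivalently, $F$ maps geodesics to geodesics). *)

(* Defs.v *)
From HB Require Import structures.
From mathcomp Require Import all_boot all_order all_algebra.
From mathcomp Require Import all_classical all_reals all_analysis.

Set Implicit Arguments.
Unset Strict Implicit.
Unset Printing Implicit Defensive.
Import Order.TTheory GRing.Theory Num.Theory.
Import numFieldNormedType.Exports.
Local Open Scope classical_set_scope.
Local Open Scope ring_scope.

(* C^oo on an open subset U of a finite-dimensional space: every iterated
   directional derivative is differentiable at every point of U. *)
Definition smooth_on (R : realType) (V W : normedModType R)
    (U : set V) (f : V -> W) : Prop :=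
  forall (vs : seq V) (x : V), U x ->
    differentiable (foldr (fun v (g : V -> W) => 'D_v g) f vs) x.

(* A chart is defined on [cdom]; the values of [cmap] outside [cdom] and of
   [cinv] outside the image of [cdom] are irrelevant. *)
Record chart (R : realType) (n : nat) (T : Type) := Chart {
  cdom : set T;
  cmap : T -> 'rV[R]_n;
  cinv : 'rV[R]_n -> T }.

(* [chart_at x] is a choice of a chart around x. It serves to represent the
   tangent space at x as 'rV_n: a row u stands for the tangent vector whose
   components in [chart_at x] are u, and a column a for the covector
   u |-> u *m a. The components in another chart c are obtained through the
   Jacobian of the change of coordinates (see [jac_to] and [jac_from]), and
   smoothness of tensor fields is always expressed in a fixed chart. *)
Record atlas (R : realType) (n : nat) (T : Type) := Atlas {
  charts : set (chart R n T);
  chart_at : T -> chart R n T }.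

Record manifold (R : realType) (n : nat) := Manifold {
  mcarrier :> topologicalType;
  matlas :> atlas R n mcarrier;
  manifold_hausdorff : hausdorff_space mcarrier;
  manifold_second_countable : @second_countable mcarrier;
  chart_at_charts : forall x : mcarrier, charts matlas (chart_at matlas x);
  chart_at_dom : forall x : mcarrier, cdom (chart_at matlas x) x;
  open_cdom : forall c, charts matlas c -> open (cdom c);
  open_cimg : forall c, charts matlas c -> open (cmap c @` cdom c);
  cmap_continuous : forall c, charts matlas c ->
    {in cdom c, continuous (cmap c)};
  cinv_continuous : forall c, charts matlas c ->
    {in cmap c @` cdom c, continuous (cinv c)};
  cmapK : forall c, charts matlas c -> {in cdom c, cancel (cmap c) (cinv c)};
  chart_compat : forall c d, charts matlas c -> charts matlas d ->
    smooth_on (cmap c @` (cdom c `&` cdom d)) (cmap d \o cinv c) }.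

Definition vector_field (R : realType) (n : nat) (T : Type)
  (A : atlas R n T) := T -> 'rV[R]_n.
Definition one_form (R : realType) (n : nat) (T : Type)
  (A : atlas R n T) := T -> 'cV[R]_n.
(* Contravariant 2-tensors, symmetric or skew-symmetric. *)
Definition bivector_field (R : realType) (n : nat) (T : Type)
  (A : atlas R n T) := T -> 'M[R]_n.

Section Tensors.
Variables (R : realType) (n : nat) (T : Type) (A : atlas R n T).
Local Notation vector_field := (vector_field A).
Local Notation one_form := (one_form A).
Local Notation bivector_field := (bivector_field A).

Definition pairing (a : 'cV[R]_n) (u : 'rV[R]_n) : R := (u *m a) 0 0.
Definition bival (h : 'M[R]_n) (a b : 'cV[R]_n) : R := (a^T *m h *m b) 0 0.
Definition sharp (h : bivector_field) (a : one_form) : vector_field :=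
  fun x => (a x)^T *m h x.

(* u *m jac_to c x is the row of components in the chart c of u in T_x. *)
Definition jac_to (c : chart R n T) (x : T) : 'M[R]_n :=
  jacobian (cmap c \o cinv (chart_at A x)) (cmap (chart_at A x) x).
(* w *m jac_from c x is the vector in T_x with components w in the chart c. *)
Definition jac_from (c : chart R n T) (x : T) : 'M[R]_n :=
  jacobian (cmap (chart_at A x) \o cinv c) (cmap c x).

(* The vector field on cdom c with constant components w in the chart c. *)
Definition const_field (c : chart R n T) (w : 'rV[R]_n) : vector_field :=
  fun x => w *m jac_from c x.
Definition frame (c : chart R n T) (i : 'I_n) : vector_field :=
  const_field c (delta_mx 0 i).

Definition vf_rep (c : chart R n T) (X : vector_field) (p : 'rV[R]_n) :=
  X (cinv c p) *m jac_to c (cinv c p).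
Definition form_rep (c : chart R n T) (a : one_form) (p : 'rV[R]_n) :=
  jac_from c (cinv c p) *m a (cinv c p).
Definition bivector_rep (c : chart R n T) (h : bivector_field)
    (p : 'rV[R]_n) :=
  (jac_to c (cinv c p))^T *m h (cinv c p) *m jac_to c (cinv c p).

Definition smooth_fun (U : set T) (f : T -> R) : Prop :=
  forall c, charts A c -> smooth_on (cmap c @` (cdom c `&` U)) (f \o cinv c).
Definition smooth_vf (U : set T) (X : vector_field) : Prop :=
  forall c, charts A c -> smooth_on (cmap c @` (cdom c `&` U)) (vf_rep c X).
Definition smooth_form (U : set T) (a : one_form) : Prop :=
  forall c, charts A c -> smooth_on (cmap c @` (cdom c `&` U)) (form_rep c a).
Definition smooth_bivector (U : set T) (h : bivector_field) : Prop :=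
  forall c, charts A c ->
    smooth_on (cmap c @` (cdom c `&` U)) (bivector_rep c h).

(* The derivative of f at x along u in T_x. *)
Definition dirder (f : T -> R) (x : T) (u : 'rV[R]_n) : R :=
  'D_u (f \o cinv (chart_at A x)) (cmap (chart_at A x) x).
Definition differential (f : T -> R) : one_form :=
  fun x => \col_i dirder f x (delta_mx 0 i).

Definition lie_bracket (X Y : vector_field) : vector_field := fun x =>
  let c := chart_at A x in
  'D_(X x) (vf_rep c Y) (cmap c x) - 'D_(Y x) (vf_rep c X) (cmap c x).

Definition hamiltonian (h : bivector_field) (f : T -> R) : vector_field :=
  sharp h (differential f).
Definition bracket (P : bivector_field) (f g : T -> R) : T -> R :=
  fun x => bival (P x) (differential f x) (differential g x).

End Tensors.
Arguments smooth_fun {R n T} A U f.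
Arguments smooth_vf {R n T} A U X.
Arguments smooth_form {R n T} A U a.
Arguments smooth_bivector {R n T} A U h.

Section Maps.
Variables (R : realType) (n1 n2 : nat) (T1 T2 : Type).
Variables (A1 : atlas R n1 T1) (A2 : atlas R n2 T2) (F : T1 -> T2).

(* The tangent map at x is u |-> u *m dmap x. *)
Definition dmap (x : T1) : 'M[R]_(n1, n2) :=
  jacobian (cmap (chart_at A2 (F x)) \o F \o cinv (chart_at A1 x))
    (cmap (chart_at A1 x) x).

Definition pullback (a : one_form A2) : one_form A1 :=
  fun x => dmap x *m a (F x).

Definition F_related (X : vector_field A1) (Y : vector_field A2) : Prop :=
  forall x, X x *m dmap x = Y (F x).

Definition poisson_map (P1 : bivector_field A1) (P2 : bivector_field A2) :=
  forall f g : T2 -> R, smooth_fun A2 setT f -> smooth_fun A2 setT g ->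
  forall x, bracket P1 (f \o F) (g \o F) x = bracket P2 f g (F x).

Definition kv_map (h1 : bivector_field A1) (h2 : bivector_field A2) :=
  forall a b : one_form A2, smooth_form A2 setT a -> smooth_form A2 setT b ->
  forall x, bival (h1 x) (pullback a x) (pullback b x) =
            bival (h2 (F x)) (a (F x)) (b (F x)).

End Maps.

Definition smooth_map (R : realType) (n1 n2 : nat)
    (M1 : manifold R n1) (M2 : manifold R n2) (F : M1 -> M2) : Prop :=
  continuous F /\
  forall c d, charts M1 c -> charts M2 d ->
    smooth_on (cmap c @` (cdom c `&` F @^-1` cdom d)) (cmap d \o F \o cinv c).

(* nabla Y x u is the covariant derivative at x along u in T_x of a vector
   field Y defined and smooth near x. A connection on TM acts on vector fields
   over open sets compatibly with restriction ([nabla_local]); a connection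
   given on global vector fields extends uniquely to such an operator. *)
Record connection (R : realType) (n : nat) (M : manifold R n) := Connection {
  nabla : vector_field M -> M -> 'rV[R]_n -> 'rV[R]_n;
  nabla_linear : forall (U : set M) (Y : vector_field M) (x : M),
    open U -> smooth_vf M U Y -> U x ->
    forall (k : R) (u v : 'rV[R]_n),
      nabla Y x (k *: u + v) = k *: nabla Y x u + nabla Y x v;
  nabla_add : forall (U : set M) (Y Z : vector_field M) (x : M),
    open U -> smooth_vf M U Y -> smooth_vf M U Z -> U x ->
    forall u, nabla (fun y => Y y + Z y) x u = nabla Y x u + nabla Z x u;
  nabla_leibniz : forall (U : set M) (f : M -> R) (Y : vector_field M) (x : M),
    open U -> smooth_fun M U f -> smooth_vf M U Y -> U x ->
    forall u, nabla (fun y => f y *: Y y) x u =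
              dirder M f x u *: Y x + f x *: nabla Y x u;
  nabla_local : forall (U : set M) (Y Z : vector_field M) (x : M),
    open U -> smooth_vf M U Y -> {in U, Y =1 Z} -> U x ->
    nabla Y x =1 nabla Z x;
  nabla_smooth : forall (U : set M) (X Y : vector_field M),
    open U -> smooth_vf M U X -> smooth_vf M U Y ->
    smooth_vf M U (fun x => nabla Y x (X x)) }.

Section Connections.
Variables (R : realType) (n : nat) (M : manifold R n) (D : connection M).

Definition torsion_free : Prop :=
  forall (U : set M) (X Y : vector_field M), open U ->
    smooth_vf M U X -> smooth_vf M U Y ->
  forall x, U x ->
    nabla D Y x (X x) - nabla D X x (Y x) = lie_bracket X Y x.

Definition flat : Prop :=
  forall (U : set M) (X Y Z : vector_field M), open U ->
    smooth_vf M U X -> smooth_vf M U Y -> smooth_vf M U Z ->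
  forall x, U x ->
    nabla D (fun y => nabla D Z y (Y y)) x (X x)
    - nabla D (fun y => nabla D Z y (X y)) x (Y x)
    - nabla D Z x (lie_bracket X Y x) = 0.

(* (nabla_u b)(e_j) = u(b(e_j)) - b(nabla_u e_j) for the coordinate frame e_j
   of chart_at x. *)
Definition nabla_form (x : M) (u : 'rV[R]_n) (b : one_form M) : 'cV[R]_n :=
  let e := frame M (chart_at M x) in
  \col_j (dirder M (fun y => pairing (b y) (e j y)) x u
          - pairing (b x) (nabla D (e j) x u)).

(* ((nabla_u h)(b, g))(x). *)
Definition nabla_bivector (h : bivector_field M) (x : M) (u : 'rV[R]_n)
    (b g : one_form M) : R :=
  dirder M (fun y => bival (h y) (b y) (g y)) x u
  - bival (h x) (nabla_form x u b) (g x)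
  - bival (h x) (b x) (nabla_form x u g).

Definition kv_identity (h : bivector_field M) : Prop :=
  forall a b g : one_form M, smooth_form M setT a -> smooth_form M setT b ->
    smooth_form M setT g ->
  forall x, nabla_bivector h x (sharp h a x) b g =
            nabla_bivector h x (sharp h b x) a g.

Definition kv_manifold (h : bivector_field M) : Prop :=
  [/\ flat /\ torsion_free, smooth_bivector M setT h,
      forall x, (h x)^T = h x & kv_identity h].

Definition smooth_curve (I : set R) (gam : R -> M) : Prop :=
  (forall t, I t -> {for t, continuous gam}) /\
  forall c, charts M c ->
    smooth_on (I `&` gam @^-1` cdom c) (cmap c \o gam).

Definition velocity (gam : R -> M) (t : R) : 'rV[R]_n :=
  derive1 (cmap (chart_at M (gam t)) \o gam) t.

Definition smooth_along (I : set R) (gam : R -> M) (V : R -> 'rV[R]_n) :=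
  forall c, charts M c ->
    smooth_on (I `&` gam @^-1` cdom c) (fun t => V t *m jac_to M c (gam t)).

(* If V = sum_j V^j e_j in the coordinate frame of chart_at (gam t), then
   DV/dt = sum_j (V^j)' e_j + sum_j V^j nabla_(gam') e_j at t. *)
Definition cov_der (gam : R -> M) (V : R -> 'rV[R]_n) (t : R) : 'rV[R]_n :=
  let c := chart_at M (gam t) in
  derive1 (fun s => V s *m jac_to M c (gam s)) t
  + \sum_j V t 0 j *: nabla D (frame M c j) (gam t) (velocity gam t).

Definition parallel_along (I : set R) (gam : R -> M) (V : R -> 'rV[R]_n) :=
  smooth_along I gam V /\ forall t, I t -> cov_der gam V t = 0.

End Connections.

(* By locality of parallelism, it is enough to use curves parametrized by open
   intervals. *)
Definition affine_map (R : realType) (n1 n2 : nat)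
    (M1 : manifold R n1) (M2 : manifold R n2)
    (D1 : connection M1) (D2 : connection M2) (F : M1 -> M2) : Prop :=
  smooth_map F /\
  forall (I : set R) (gam : R -> M1) (V : R -> 'rV[R]_n1),
    open I -> is_interval I -> smooth_curve I gam ->
    parallel_along D1 I gam V ->
    parallel_along D2 I (F \o gam) (fun t => V t *m dmap M1 M2 F (gam t)).

(* The total space of TM is M * 'rV_n, (x, v) standing for v in T_x; its
   manifold structure is the one given by the charts induced by those of M,
   not the product one. *)
Definition tangent_chart (R : realType) (n : nat) (T : Type)
    (A : atlas R n T) (c : chart R n T) : chart R (n + n) (T * 'rV[R]_n) :=
  {| cdom := [set w | cdom c w.1];
     cmap := fun w => row_mx (cmap c w.1) (w.2 *m jac_to A c w.1);
     cinv := fun q =>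
       let x := cinv c (lsubmx q) in (x, rsubmx q *m jac_from A c x) |}.

Definition tangent_atlas (R : realType) (n : nat) (T : Type)
    (A : atlas R n T) : atlas R (n + n) (T * 'rV[R]_n) :=
  {| charts := tangent_chart A @` charts A;
     chart_at := fun w => tangent_chart A (chart_at A w.1) |}.

Definition tangent_map (R : realType) (n1 n2 : nat) (T1 T2 : Type)
    (A1 : atlas R n1 T1) (A2 : atlas R n2 T2) (F : T1 -> T2)
    (w : T1 * 'rV[R]_n1) : T2 * 'rV[R]_n2 :=
  (F w.1, w.2 *m dmap A1 A2 F w.1).

Section Lifts.
Variables (R : realType) (n : nat) (M : manifold R n) (D : connection M).
Implicit Types (w : M * 'rV[R]_n) (a b : 'cV[R]_n).

(* The endomorphism u |-> sum_j v^j nabla_u e_j of T_x, for w = (x, v) and the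
   coordinate frame e_j of chart_at x. *)
Definition christoffel w : 'M[R]_n :=
  let e := frame M (chart_at M w.1) in
  \sum_j w.2 0 j *: lin1_mx (nabla D (e j) w.1).

(* The lifts to T_w TM of u in T_(w.1) M are u *m vlift and u *m hlift w. A
   curve (gam, V) in TM is horizontal when V is parallel along gam, that is,
   when the components of V satisfy V' = - gam' *m christoffel (gam, V). *)
Definition vlift : 'M[R]_(n, n + n) := row_mx 0 1%:M.
Definition hlift w : 'M[R]_(n, n + n) := row_mx 1%:M (- christoffel w).

Definition vform w a : 'cV[R]_(n + n) := col_mx (christoffel w *m a) a.
Definition hform a : 'cV[R]_(n + n) := col_mx a 0.

(* Pi(a, b) = h(a o hlift, b o vlift) - h(b o hlift, a o vlift); see
   [assoc_bivectorP]. *)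
Definition assoc_bivector (h : bivector_field M) :
    bivector_field (tangent_atlas M) := fun w =>
  let K := (hlift w)^T *m h w.1 *m vlift in K - K^T.

Lemma vformP w a :
  (forall u, pairing (vform w a) (u *m vlift) = pairing a u) /\
  (forall u, pairing (vform w a) (u *m hlift w) = 0).
Proof.
split=> u; rewrite /pairing /vform /vlift /hlift -mulmxA mul_row_col.
  by rewrite mul0mx mul1mx add0r.
by rewrite mul1mx mulNmx subrr mulmx0 mxE.
Qed.

Lemma hformP w a :
  (forall u, pairing (hform a) (u *m hlift w) = pairing a u) /\
  (forall u, pairing (hform a) (u *m vlift) = 0).
Proof.
split=> u; rewrite /pairing /hform /vlift /hlift -mulmxA mul_row_col.
  by rewrite mulmx0 mul1mx addr0.
by rewrite mul0mx mulmx0 addr0 mulmx0 mxE.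
Qed.

Lemma form_decomposition w (a : 'cV[R]_(n + n)) :
  a = hform (hlift w *m a) + vform w (vlift *m a).
Proof.
rewrite -{1 2 3}[a]vsubmxK /hform /vform /hlift /vlift !mul_row_col.
by rewrite !mul0mx !mul1mx add0r add_col_mx mulNmx subrK add0r.
Qed.

Lemma assoc_bivectorP (h : bivector_field M) w a b :
  let P := bival (assoc_bivector h w) in
  [/\ P (vform w a) (vform w b) = 0, P (hform a) (hform b) = 0,
      P (hform a) (vform w b) = bival (h w.1) a b &
      P (vform w b) (hform a) = - bival (h w.1) a b].
Proof.
have Hh c : hlift w *m hform c = c.
  by rewrite /hlift /hform mul_row_col mul1mx mulmx0 addr0.
have Vh c : vlift *m hform c = 0.
  by rewrite /vlift /hform mul_row_col mul0mx mulmx0 addr0.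
have Hv c : hlift w *m vform w c = 0.
  by rewrite /hlift /vform mul_row_col mul1mx mulNmx subrr.
have Vv c : vlift *m vform w c = c.
  by rewrite /vlift /vform mul_row_col mul0mx mul1mx add0r.
have E (c d : 'cV[R]_(n + n)) : bival (assoc_bivector h w) c d =
    bival (h w.1) (hlift w *m c) (vlift *m d)
    - bival (h w.1) (hlift w *m d) (vlift *m c).
  have subE (X Y : 'M[R]_1) : (X - Y) 0 0 = X 0 0 - Y 0 0 by rewrite !mxE.
  rewrite /bival /assoc_bivector mulmxBr mulmxBl subE; congr (_ - _).
    by rewrite trmx_mul !mulmxA.
  rewrite -[d in LHS]trmxK -!trmx_mul mxE; congr (_ 0 0).
  by rewrite trmx_mul !mulmxA.
have b0l c : bival (h w.1) 0 c = 0 by rewrite /bival trmx0 !mul0mx mxE.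
have b0r c : bival (h w.1) c 0 = 0 by rewrite /bival mulmx0 mxE.
by split; rewrite E ?Hh ?Vh ?Hv ?Vv ?b0l ?b0r ?subr0 ?sub0r ?oppr0.
Qed.

End Lifts.

(* Main.v *)
(* Each assertion is equivalent to the identity A^T *m h1 x *m A = h2 (F x), with
   A = T_x F, at every point x. For (i), (iii) and (iv) this is linear algebra, as
   bump functions realize every covector of M2 as a differential. For (ii), being
   affine means that TF maps horizontal lifts to horizontal lifts (it always does
   so for vertical lifts), so that TF pushes Pi1 to the bivector obtained from
   A^T *m h1 x *m A; conversely, the bracket of f o p with a fibrewise linear
   function df' on the zero section recovers the identity.
   The horizontal part uses parallel fields along lines in a chart, hence the
   existence and smoothness of solutions of linear differential equations. *)
From HB Require Import structures.
Require Import Defs.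
From mathcomp Require Import all_boot all_order all_algebra.
From mathcomp Require Import all_classical all_reals all_analysis.
From mathcomp Require Import ring lra.

Set Implicit Arguments.
Unset Strict Implicit.
Unset Printing Implicit Defensive.
Import Order.TTheory GRing.Theory Num.Theory.
Import numFieldNormedType.Exports.
Local Open Scope classical_set_scope.
Local Open Scope ring_scope.

(** * Smooth functions *)

(** The hypothesis on [F] speaks only of parallel fields, so it yields nothing until a parallel
    field is exhibited whose initial vector v and whose curve's initial velocity u are both
    prescribed. Reading it at t = 0 then gives, for J the Jacobian of [F] in charts, the identity v
    (D_u J) + (uJ) Gamma2(vJ) = u Gamma1(v) J, where Gamma is the matrix [christoffel]. This is
    exactly the compatibility of the tangent map with horizontal lifts. A second obstacle shapes the
    computations: tangent vectors at x are written in [chart_at M x], a choice that need not vary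
    continuously with x, so components in this form cannot be differentiated. Each derivative is
    therefore taken in one fixed chart, reached through [jac_to] and [jac_from], and the
    transformation law of the Christoffel symbols accounts for the change of chart. *)

Section SmoothCalculus.
Variable R : realType.
Implicit Types V W : normedModType R.

(** The difference [g - f] vanishes near x, hence is its own remainder with the zero map as
    differential; adding it to [f] gives [g]. *)
Lemma near_eq_differentiable V W (f g : V -> W) (x : V) :
  {near x, f =1 g} -> differentiable f x -> differentiable g x.
Proof.
move=> fg df.
have -> : g = f + (g - f) by rewrite addrC subrK.
apply: differentiableD => //.
set k := g - f.
have k0 : \forall y \near x, k y = 0.
  near=> y; rewrite -[LHS]/(g y - f y); apply/eqP; rewrite subr_eq0 eq_sym.
  by apply/eqP; near: y.
have H : k \o shift x = cst (k x) + \0 +o_ 0 id.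
  apply/eqaddoP => e e0; near=> y.
  have -> : (k \o shift x - (cst (k x) + \0)) y = 0.
    rewrite -[LHS]/(k (y + x) - (k x + 0)) addr0 (nbhs_singleton k0) subr0.
    near: y.
    by move: k0; rewrite (near_shift 0 x) /=; apply: filterS => y; rewrite /= subr0.
  by rewrite normr0 mulr_ge0 // ltW.
have c0 : continuous (\0 : V -> W) by exact: cst_continuous.
by apply/diff_locallyP; rewrite (diff_unique c0 H).
Unshelve. all: by end_near. Qed.

(* Differentiable up to order k.+1 on U, in the sense of [smooth_on]. *)
Fixpoint Ck (k : nat) V W (U : set V) (f : V -> W) : Prop :=
  (forall x, U x -> differentiable f x) /\
  (if k is k'.+1 then forall v, Ck k' U ('D_v f) else True).

Lemma Ck_differentiable k V W U (f : V -> W) x :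
  Ck k U f -> U x -> differentiable f x.
Proof. by case: k => [|k] [+ _]; exact. Qed.

(** [foldr] applies the last vector of the list first, so differentiating [f] beforehand amounts to
    appending v to the list. *)
Lemma smooth_on_derive V W U (f : V -> W) v :
  smooth_on U f -> smooth_on U ('D_v f).
Proof. by move=> sf vs x Ux; move: (sf (rcons vs v) x Ux); rewrite foldr_rcons. Qed.

(** Trades lists of directions for an order of differentiability, on which the closure properties
    below go by induction. *)
Lemma smooth_onP V W (U : set V) (f : V -> W) :
  smooth_on U f <-> forall k, Ck k U f.
Proof.
split=> [sf k|].
  elim: k f sf => [|k IH] f sf; split=> //; try by move=> x; exact: (sf [::] x).
  by move=> v; apply/IH/smooth_on_derive.
move=> + vs; elim/last_ind: vs f => [|vs v IH] f cf x Ux.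
  exact: Ck_differentiable (cf 0) Ux.
by rewrite foldr_rcons; apply: IH => // k; have [_] := cf k.+1; exact.
Qed.

Lemma Ck_sub k V W (U U' : set V) (f : V -> W) :
  U' `<=` U -> Ck k U f -> Ck k U' f.
Proof.
move=> sU; elim: k f => [|k IH] f [df Df]; split=> //.
- by move=> x /sU /df.
- by move=> x /sU /df.
- by move=> v; apply: IH; exact: Df.
Qed.

Lemma CkU k V W (U U' : set V) (f : V -> W) :
  Ck k U f -> Ck k U' f -> Ck k (U `|` U') f.
Proof.
elim: k f => [|k IH] f [df Df] [df' Df']; split=> //.
- by move=> x [/df|/df'].
- by move=> x [/df|/df'].
- by move=> v; apply: IH; [exact: Df|exact: Df'].
Qed.

Lemma CkW k V W (U : set V) (f : V -> W) : Ck k.+1 U f -> Ck k U f.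
Proof.
elim: k f => [|k IH] f [df Df]; split=> // v; apply: IH; exact: Df.
Qed.

(** Openness lets an equality on [U] hold near each point, and so pass to the derivatives. *)
Lemma Ck_ext k V W (U : set V) (f g : V -> W) : open U ->
  (forall x, U x -> f x = g x) -> Ck k U f -> Ck k U g.
Proof.
move=> oU; elim: k f g => [|k IH] f g fg [df Df]; split=> //.
- move=> x Ux; apply: near_eq_differentiable (df _ Ux).
  by apply: filterS (open_nbhs_nbhs (conj oU Ux)) => y; exact: fg.
- move=> x Ux; apply: near_eq_differentiable (df _ Ux).
  by apply: filterS (open_nbhs_nbhs (conj oU Ux)) => y; exact: fg.
- move=> v; apply: IH (Df v) => x Ux; apply: near_eq_derive.
  by apply: filterS (open_nbhs_nbhs (conj oU Ux)) => y; exact: fg.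
Qed.

Lemma Ck_cst k V W (U : set V) (w : W) : Ck k U (fun=> w).
Proof.
elim: k w => [|k IH] w; split=> //; try by move=> x _; exact: differentiable_cst.
move=> v; have -> : 'D_v (fun=> w) = (fun=> 0 : W) :> (V -> W).
  by apply/funext => x; exact: derive_cst.
exact: IH.
Qed.

Lemma CkD k V W (U : set V) (f g : V -> W) : open U ->
  Ck k U f -> Ck k U g -> Ck k U (fun x => f x + g x).
Proof.
move=> oU; elim: k f g => [|k IH] f g cf cg; split=> //.
- by move=> x Ux; apply: differentiableD; [exact: cf.1|exact: cg.1].
- by move=> x Ux; apply: differentiableD; [exact: cf.1|exact: cg.1].
move=> v; apply: Ck_ext (IH _ _ (cf.2 v) (cg.2 v)) => // x Ux.
by rewrite -deriveD //; apply: diff_derivable; [exact: cf.1|exact: cg.1].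
Qed.

Lemma CkZl k V W (U : set V) (f : V -> R) (w : W) : open U ->
  Ck k U f -> Ck k U (fun x => f x *: w).
Proof.
move=> oU; elim: k f => [|k IH] f cf; split=> //.
- by move=> x Ux; apply: differentiableZl; exact: cf.1.
- by move=> x Ux; apply: differentiableZl; exact: cf.1.
move=> v; apply: Ck_ext (IH _ (cf.2 v)) => // x Ux.
have df := cf.1 _ Ux.
by rewrite !deriveE ?diffZl //; exact: differentiableZl.
Qed.

Lemma CkM k V (U : set V) (f g : V -> R) : open U ->
  Ck k U f -> Ck k U g -> Ck k U (fun x => f x * g x).
Proof.
move=> oU; elim: k f g => [|k IH] f g cf cg; split=> //.
- by move=> x Ux; apply: differentiableM; [exact: cf.1|exact: cg.1].
- by move=> x Ux; apply: differentiableM; [exact: cf.1|exact: cg.1].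
move=> v.
apply: Ck_ext (CkD oU (IH _ _ (CkW cf) (cg.2 v)) (IH _ _ (CkW cg) (cf.2 v))) => //.
move=> x Ux; rewrite deriveM //; apply: diff_derivable; [exact: cf.1|exact: cg.1].
Qed.

Lemma Ck_sum k V W (U : set V) (I : Type) (r : seq I) (f : I -> V -> W) :
  open U -> (forall i, Ck k U (f i)) -> Ck k U (fun x => \sum_(i <- r) f i x).
Proof.
move=> oU cf; elim: r => [|i r IH].
  by apply: Ck_ext (Ck_cst k U 0) => // x _; rewrite big_nil.
by apply: Ck_ext (CkD oU (cf i) IH) => // x _; rewrite big_cons.
Qed.

Lemma derive_coord V m n (f : V -> 'M[R]_(m, n)) x v i j :
  differentiable f x -> 'D_v (fun y => f y i j) x = 'D_v f x i j.
Proof. by move=> df; rewrite derive_mx ?mxE //; exact: diff_derivable. Qed.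

Lemma Ck_coord k V m n (U : set V) (f : V -> 'M[R]_(m, n)) i j : open U ->
  Ck k U f -> Ck k U (fun x => f x i j).
Proof.
move=> oU; elim: k f => [|k IH] f cf; split=> //.
- move=> x Ux; apply: (@differentiable_comp _ _ _ _ f (fun N => N i j) x (cf.1 _ Ux)).
  exact: differentiable_coord.
- move=> x Ux; apply: (@differentiable_comp _ _ _ _ f (fun N => N i j) x (cf.1 _ Ux)).
  exact: differentiable_coord.
move=> v; apply: Ck_ext (IH _ (cf.2 v)) => // x Ux.
by rewrite derive_coord //; exact: cf.1.
Qed.

Lemma Ck_mx k V m n (U : set V) (f : V -> 'M[R]_(m, n)) : open U ->
  (forall i j, Ck k U (fun x => f x i j)) -> Ck k U f.
Proof.
move=> oU cf.
apply: (@Ck_ext _ _ _ _ (fun x => \sum_i \sum_j f x i j *: delta_mx i j)) => //.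
  by move=> x _; rewrite -matrix_sum_delta.
by apply: Ck_sum => // i; apply: Ck_sum => // j; exact: CkZl.
Qed.

Lemma Ck_scale k V m p (U : set V) (f : V -> R)
    (g : V -> 'M[R]_(m, p)) : open U ->
  Ck k U f -> Ck k U g -> Ck k U (fun x => f x *: g x).
Proof.
move=> oU cf cg; apply: Ck_mx => // i j.
apply: (@Ck_ext _ _ _ _ (fun x => f x * g x i j)) => //.
  by move=> x _; rewrite [RHS]mxE.
by apply: CkM => //; exact: Ck_coord.
Qed.

Lemma Ck_mulmx k V m n p (U : set V) (f : V -> 'M[R]_(m, n)) (g : V -> 'M[R]_(n, p)) :
  open U -> Ck k U f -> Ck k U g -> Ck k U (fun x => f x *m g x).
Proof.
move=> oU cf cg; apply: Ck_mx => // i j.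
apply: (@Ck_ext _ _ _ _ (fun x => \sum_l f x i l * g x l j)) => //.
  by move=> x _; rewrite mxE.
by apply: Ck_sum => // l; apply: CkM => //; exact: Ck_coord.
Qed.

Lemma derive_rV m W (f : 'rV[R]_m -> W) x v : differentiable f x ->
  'D_v f x = \sum_i v 0 i *: 'D_(delta_mx 0 i) f x.
Proof.
move=> df; rewrite deriveE // {1}(row_sum_delta v) linear_sum.
by apply: eq_bigr => i _; rewrite linearZ /= deriveE.
Qed.

Lemma derive_comp V V' W (f : V' -> W) (g : V -> V') x v :
  differentiable g x -> differentiable f (g x) ->
  'D_v (f \o g) x = 'D_('D_v g x) f (g x).
Proof.
move=> dg df; rewrite deriveE; last exact: differentiable_comp.
by rewrite diff_comp //= !deriveE.
Qed.

(** In the chain rule the direction ['D_v g x] moves with x, which blocks the induction. Expanding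
    it over the standard basis leaves fixed directions: a finite sum of products of a coordinate of
    ['D_v g] with a partial derivative of [f] composed with [g], each of lower order. *)
Lemma Ck_comp_real k V m (U : set V) (U' : set 'rV[R]_m) (f : 'rV[R]_m -> R)
    (g : V -> 'rV[R]_m) : open U -> (forall x, U x -> U' (g x)) ->
  Ck k U' f -> Ck k U g -> Ck k U (f \o g).
Proof.
move=> oU gU; elim: k f g gU => [|k IH] f g gU cf cg; split=> //.
- move=> x Ux; apply: differentiable_comp; first exact: cg.1.
  by apply: cf.1; exact: gU.
- move=> x Ux; apply: differentiable_comp; first exact: cg.1.
  by apply: cf.1; exact: gU.
move=> v; apply: (@Ck_ext _ _ _ _
  (fun x => \sum_i 'D_v g x 0 i * ('D_(delta_mx 0 i) f \o g) x)) => //.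
  move=> x Ux; have dg := cg.1 _ Ux; have df := cf.1 _ (gU _ Ux).
  rewrite [RHS]derive_comp //; exact/esym/derive_rV.
apply: Ck_sum => // i; apply: CkM => //.
  by apply: Ck_coord => //; exact: cg.2.
by apply: IH => //; [exact: cf.2|exact: CkW].
Qed.

Lemma Ck_comp k V m n p (U : set V) (U' : set 'rV[R]_m)
    (f : 'rV[R]_m -> 'M[R]_(n, p)) (g : V -> 'rV[R]_m) :
  open U -> open U' -> (forall x, U x -> U' (g x)) ->
  Ck k U' f -> Ck k U g -> Ck k U (f \o g).
Proof.
move=> oU oU' gU cf cg; apply: Ck_mx => // i j.
apply: (@Ck_comp_real _ _ _ _ U' (fun y => f y i j)) => //.
exact: Ck_coord.
Qed.

Lemma Ck_comp_1real k V (U : set V) (f : R -> R) (g : V -> R) : open U ->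
  Ck k setT f -> Ck k U g -> Ck k U (f \o g).
Proof.
move=> oU; elim: k f g => [|k IH] f g cf cg; split=> //.
- move=> x Ux; apply: differentiable_comp; first exact: cg.1.
  exact: cf.1.
- move=> x Ux; apply: differentiable_comp; first exact: cg.1.
  exact: cf.1.
move=> v; apply: (@Ck_ext _ _ _ _ (fun x => 'D_v g x * ('D_1 f \o g) x)) => //.
  move=> x Ux; have dg := cg.1 _ Ux; have df : differentiable f (g x) by exact: cf.1.
  rewrite [RHS]derive_comp // [RHS]deriveE // [in LHS]/= [X in _ * X]deriveE //.
  by rewrite -[in RHS](mulr1 ('D_v g x)) linearZ.
apply: CkM => //; first exact: cg.2.
by apply: IH; [exact: cf.2|exact: CkW].
Qed.

Lemma Ck_id k V (U : set V) : Ck k U (id : V -> V).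
Proof.
case: k => [|k]; split=> // v.
have -> : 'D_v id = (fun=> v) :> (V -> V) by apply/funext => x; exact: derive_id.
exact: Ck_cst.
Qed.

End SmoothCalculus.

(** * The maximum norm on matrices *)

Section MatrixNorm.
Variable R : realType.

Lemma coord_le_norm m n (M : 'M[R]_(m, n)) i j : `|M i j| <= `|M|.
Proof. by rewrite [leRHS]/Num.Def.normr /= mx_normrE; exact: (le_bigmax _ _ (i, j)). Qed.

Lemma norm_le_coord m n (M : 'M[R]_(m, n)) c : 0 <= c ->
  (forall i j, `|M i j| <= c) -> `|M| <= c.
Proof.
move=> c0 H; rewrite [leLHS]/Num.Def.normr /= mx_normrE.
by apply: bigmax_le => // -[i j] _; exact: H.
Qed.

Lemma norm_mulmx m n p (A : 'M[R]_(m, n)) (B : 'M[R]_(n, p)) :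
  `|A *m B| <= n%:R * (`|A| * `|B|).
Proof.
apply: norm_le_coord => [|i j]; first by rewrite !mulr_ge0.
rewrite mxE; apply: le_trans (ler_norm_sum _ _ _) _.
apply: le_trans (_ : \sum_(k < n) `|A| * `|B| <= _); last first.
  by rewrite sumr_const card_ord mulr_natl.
by apply: ler_sum => k _; rewrite normrM ler_pM // coord_le_norm.
Qed.

End MatrixNorm.

(** * Bump functions *)

Section Bump.
Variable R : realType.

(** The case k = 0 is the classical flat function exp(-1/t). The powers t^-k are those that its
    successive derivatives produce, so that the family is closed under differentiation up to linear
    combinations. *)
Definition flat_exp (k : nat) (t : R) : R :=
  if 0 < t then t^-1 ^+ k * expR (- t^-1) else 0.

(** Raise x <= 1 + x <= exp(x), for x = s / (m + 1), to the power m + 1. *)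
Lemma expn_le_expR (m : nat) (s : R) : 0 <= s ->
  s ^+ m.+1 <= m.+1%:R ^+ m.+1 * expR s.
Proof.
move=> s0; have m0 : 0 < m.+1%:R :> R by [].
have -> : expR s = expR (s / m.+1%:R) ^+ m.+1.
  by rewrite -expRM_natl -[in RHS]mulr_natl mulrC divfK ?lt0r_neq0.
rewrite -exprMn; apply: lerXn2r; rewrite ?nnegrE ?mulr_ge0 ?expR_ge0 //.
rewrite -ler_pdivrMl // mulrC; apply: le_trans (expR_ge1Dx _).
by rewrite lerDr.
Qed.

(* So all derivatives of flat_exp k vanish at 0. *)
Lemma flat_exp_le_sqr (k : nat) : exists2 C, 0 <= C &
  forall t, `|flat_exp k t| <= C * t ^+ 2.
Proof.
(* The constant of [expn_le_expR] for the exponent k + 2 and s = 1/t: the k powers of 1/t in the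
   function, and two more that become the factor t^2. *)
exists (k.+2%:R ^+ k.+2) => [|t]; first exact: exprn_ge0.
rewrite /flat_exp; case: ifPn => t0; last first.
  by rewrite normr0 mulr_ge0 ?sqr_ge0 // exprn_ge0.
rewrite ger0_norm; last by rewrite mulr_ge0 ?expR_ge0 ?exprn_ge0 ?invr_ge0 // ltW.
rewrite expRN ler_pdivrMr ?expR_gt0 //.
have /expn_le_expR H : 0 <= t^-1 by rewrite invr_ge0 ltW.
rewrite mulrAC -ler_pdivrMr ?exprn_gt0 // -exprVn -exprD addn2.
exact: H.
Qed.

Lemma is_derive_flat_exp k (t : R) :
  is_derive t 1 (flat_exp k) (flat_exp k.+2 t - k%:R * flat_exp k.+1 t).
Proof.
have [t0|t0|->] := ltgtP t 0.
- apply: (@near_eq_is_derive _ _ _ (cst 0)).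
    near=> s; rewrite /flat_exp ifF //; apply/negbTE; rewrite -leNgt ltW //.
    by near: s; exact: lt_nbhsl.
  by rewrite /flat_exp ltNge ltW //= mulr0 subr0; exact: is_derive_cst.
- apply: (@near_eq_is_derive R R R (fun s => s^-1 ^+ k * expR (- s^-1)) (flat_exp k)).
    near=> s; rewrite /flat_exp ifT //.
    by near: s; exact: lt_nbhsr.
  have tn0 : t != 0 by rewrite lt0r_neq0.
  have H : is_derive t 1 (fun s : R => s^-1) (- t ^- 2).
    apply: DeriveDef; first by apply: derivableV => //; exact: derivable_id.
    by rewrite deriveV // derive_id /GRing.scale /= mulr1.
  have HN : is_derive t 1 (fun s : R => - s^-1) (- - t ^- 2).
    exact: is_deriveN.
  have HE : is_derive t 1 (expR \o (fun s : R => - s^-1)) (expR (- t^-1) * (- - t ^- 2)).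
    exact: is_derive1_comp.
  have HX := @is_deriveX R R (fun s : R => s^-1) k t 1 _ H.
  have HM := is_deriveM HX HE.
  have -> : (fun s => s^-1 ^+ k * expR (- s^-1)) =
      ((fun s : R => s^-1) ^+ k * (expR \o (fun s : R => - s^-1)))%R.
    by apply/funext => s; rewrite /= -[RHS]/((_ ^+ k) s * _) exprfctE.
  apply: is_derive_eq HM _.
  rewrite exprfctE /flat_exp !t0 /GRing.scale /= opprK -!exprVn.
  by case: k {HX} => [|k]; rewrite !exprS ?expr0; ring.
(* At 0 the quadratic bound makes the difference quotient at most C |h|. *)
have [C C0 HC] := flat_exp_le_sqr k.
have f0 j : flat_exp j 0 = 0 by rewrite /flat_exp ltxx.
rewrite !f0 mulr0 subr0.
have H : h^-1 *: ((flat_exp k \o shift 0) (h *: (1 : R)) - flat_exp k 0)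
    @[h --> 0^'] --> (0 : R).
  apply/cvgrPdist_le => e e0; near=> h.
  rewrite /= f0 subr0 addr0 sub0r normrN [h *: 1]mulr1 /GRing.scale /= normrM.
  have hn0 : h != 0 by near: h; exact: nbhs_dnbhs_neq.
  have h0 : 0 < `|h| by rewrite normr_gt0.
  rewrite normfV ler_pdivrMl //; apply: le_trans (HC h) _.
  rewrite -real_normK ?num_real // expr2 mulrA mulrC ler_pM2l //.
  (* C may be 0, whereas C + 1 can be divided by. *)
  apply: (@le_trans _ _ ((C + 1) * `|h|)); first by rewrite ler_pM2r // lerDl.
  rewrite -ler_pdivlMl ?ltr_wpDl //.
  by near: h; apply: dnbhs0_le; rewrite mulr_gt0 // invr_gt0 ltr_wpDl.
split; first by apply/cvg_ex; exists 0.
exact/cvg_lim.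
Unshelve. all: by end_near. Qed.

Lemma Ck_flat_exp j k : Ck j setT (flat_exp k).
Proof.
have df k' (t : R) : differentiable (flat_exp k') t.
  by apply/derivable1_diffP; have [] := is_derive_flat_exp k' t.
elim: j k => [|j IH] k; split=> // v.
apply: (@Ck_ext _ _ _ _ _
  (fun t => v * (flat_exp k.+2 t + (- k%:R) * flat_exp k.+1 t))).
- exact: openT.
- move=> t _; have [_ E] := is_derive_flat_exp k t.
  rewrite mulNr -E !deriveE //.
  by rewrite -[in RHS](mulr1 v) linearZ.
have oT := @openT R.
apply: CkM => //; first exact: Ck_cst.
apply: CkD => //; apply: CkM => //; exact: Ck_cst.
Qed.

Lemma flat_exp_gt0 k (t : R) : 0 < t -> 0 < flat_exp k t.
Proof. by move=> t0; rewrite /flat_exp t0 mulr_gt0 ?expR_gt0 ?exprn_gt0 ?invr_gt0. Qed.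

(* The witness is l(q - p) * exp(-1 / (r^2 - |q - p|_2^2)) suitably normalized,
   with l the linear form of coefficients a. *)
Lemma bump_exists n (p : 'rV[R]_n) (a : 'cV[R]_n) (r : R) : 0 < r ->
  exists g : 'rV[R]_n -> R, [/\ smooth_on setT g,
    forall v, 'D_v g p = (v *m a) 0 0 &
    forall q, r <= `|q - p| -> g q = 0].
Proof.
move=> r0.
pose s (q : 'rV[R]_n) := r ^+ 2 + (- 1) * \sum_i (q 0 i + (- p 0 i)) * (q 0 i + (- p 0 i)).
pose c := flat_exp 0 (r ^+ 2).
have c0 : 0 < c by apply: flat_exp_gt0; exact: exprn_gt0.
pose l (q : 'rV[R]_n) := c^-1 * \sum_i (q 0 i + (- p 0 i)) * a i 0.
have oT := @openT ('rV[R]_n).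
have cx k i : Ck k setT (fun q : 'rV[R]_n => q 0 i + (- p 0 i)).
  apply: CkD => //; last exact: Ck_cst.
  by apply: (@Ck_coord _ _ _ _ _ _ id) => //; exact: Ck_id.
have cs k : Ck k setT s.
  apply: CkD => //; first exact: Ck_cst.
  apply: CkM => //; first exact: Ck_cst.
  by apply: Ck_sum => // i; apply: CkM.
have cl k : Ck k setT l.
  apply: CkM => //; first exact: Ck_cst.
  by apply: Ck_sum => // i; apply: CkM => //; exact: Ck_cst.
have cf k : Ck k setT (flat_exp 0 \o s).
  by apply: Ck_comp_1real => //; exact: Ck_flat_exp.
exists (fun q => l q * (flat_exp 0 \o s) q); split.
- by apply/smooth_onP => k; exact: CkM.
- move=> v.
  have dl := Ck_differentiable (cl 0) (I : setT p).
  have df := Ck_differentiable (cf 0) (I : setT p).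
  have lp : l p = 0.
    by rewrite /l big1 ?mulr0 // => i _; rewrite subrr mul0r.
  have sp : s p = r ^+ 2.
    by rewrite /s big1 ?mulr0 ?addr0 // => i _; rewrite subrr mul0r.
  (* Since [l] vanishes at p, the Leibniz rule leaves ['D_v l p] times the value [c] of the
     exponential factor at p, which the factor c^-1 in [l] cancels. *)
  rewrite deriveM; [|exact: diff_derivable..].
  rewrite lp scale0r add0r /= sp -/c.
  have -> : 'D_v l p = c^-1 * (v *m a) 0 0.
    apply: cvg_lim => //; apply: cvg_near_cst; near=> h.
    have hn0 : h != 0 by near: h; exact: nbhs_dnbhs_neq.
    rewrite lp subr0 /= /l mxE /GRing.scale /= mulrCA; congr (_ * _).
    rewrite mulr_sumr; apply: eq_bigr => i _.
    by rewrite !mxE addrK -mulrA mulKf.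
  by rewrite /GRing.scale /= mulrA divff ?mul1r ?gt_eqF.
- move=> q rq; rewrite /= /flat_exp ifF ?mulr0 //.
  apply/negbTE; rewrite -leNgt /s mulN1r subr_le0.
  (* The norm is the maximum of the coordinates while [s] involves the sum of their squares: the
     coordinate attaining the maximum alone makes this sum at least r^2. *)
  have /mx_norm_neq0[[i j] /= Eij] : `|q - p| != 0 by rewrite gt_eqF // (lt_le_trans r0).
  move: rq; rewrite [leRHS]Eij (ord1 i) !mxE => rq.
  apply: le_trans (_ : `|q 0 j - p 0 j| ^+ 2 <= _).
    by rewrite lerXn2r ?nnegrE // ltW.
  rewrite real_normK ?num_real // expr2 (bigD1 j) //= lerDl.
  by apply: sumr_ge0 => l' _; rewrite -expr2 sqr_ge0.
Unshelve. all: by end_near. Qed.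

End Bump.

(** * Linear differential equations *)

Section LinearODE.
Variable R : realType.

Lemma antiderivative_exists (f : R -> R) : continuous f ->
  exists G : R -> R, G 0 = 0 /\
    forall t : R, `|t| < 1 -> is_derive t 1 G (f t).
Proof.
move=> cf.
(* Integrating from -1 rather than 0 makes every t with |t| < 1, negative ones included, an interior
   point; the value at 0 is subtracted afterwards. *)
pose F (x : R) : R := (\int[@lebesgue_measure R]_(t in `[(- 1 : R), x]) f t)%R.
exists (fun t => F t - F 0); split; first by rewrite subrr.
move=> t; rewrite ltr_norml => /andP[t1 t2].
have [dF EF] : derivable F t 1 /\ derive1 F t = f t.
  apply: (@continuous_FTC1_closed _ f (-1) t 1) => //.
    by apply: continuous_compact_integrable; [exact: segment_compact|exact: continuous_subspaceT].
  exact: cf.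
have H : is_derive t 1 F (f t) by apply: (DeriveDef dF); rewrite -derive1E.
by have := is_deriveB H (is_derive_cst (F 0) t 1); rewrite subr0.
Qed.

Lemma is_derive_mxP (V : normedModType R) m n (M : V -> 'M[R]_(m, n)) t v D :
  is_derive t v M D <-> forall i j, is_derive t v (fun x => M x i j) (D i j).
Proof.
split=> [[dM <-] i j|H].
  apply: DeriveDef; first by move/derivable_mxP: dM; exact.
  by rewrite derive_mx // mxE.
have dM : derivable M t v by apply/derivable_mxP => i j; have [] := H i j.
apply: DeriveDef => //; rewrite derive_mx //; apply/matrixP => i j.
by rewrite mxE; have [] := H i j.
Qed.

Lemma derive_bound_real (D d : R -> R) (c t : R) : `|t| < 1 -> 0 <= c ->
  (forall s : R, `|s| < 1 -> is_derive s 1 D (d s)) ->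
  (forall s, `|s| <= `|t| -> `|d s| <= c) -> `|D t - D 0| <= c * `|t|.
Proof.
move=> t1 c0 dD dc.
have cD s : `|s| < 1 -> {for s, continuous D}.
  move=> s1; apply: differentiable_continuous; apply/derivable1_diffP.
  by have [] := dD s s1.
have [t0|t0|->] := ltgtP t 0; last by rewrite subrr normr0 mulr_ge0.
- have [||s] := @MVT R D d t 0 t0.
  + move=> s; rewrite in_itv /= => /andP[ts s0]; apply: dD.
    by move: t1; rewrite !ltr0_norm //; lra.
  + apply: continuous_in_subspaceT => s; rewrite inE /= in_itv /= => /andP[ts s0].
    by apply: cD; move: t1; rewrite ltr0_norm // ler0_norm //; lra.
  rewrite in_itv /= => /andP[ts s0] E.
  rewrite distrC E normrM sub0r normrN ler_wpM2r //; apply: dc.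
  by rewrite !ltr0_norm //; lra.
- have [||s] := @MVT R D d 0 t t0.
  + move=> s; rewrite in_itv /= => /andP[ts s0]; apply: dD.
    by move: t1; rewrite !gtr0_norm //; lra.
  + apply: continuous_in_subspaceT => s; rewrite inE /= in_itv /= => /andP[ts s0].
    by apply: cD; move: t1; rewrite gtr0_norm // ger0_norm //; lra.
  rewrite in_itv /= => /andP[ts s0] E.
  rewrite E normrM subr0 ler_wpM2r //; apply: dc.
  by rewrite !gtr0_norm //; lra.
Qed.

(** Antiderivatives chosen by one operator on all functions, so that the Picard map built from it
    can be iterated. On functions that are not continuous its value is arbitrary. *)
Lemma antiderivative_rV n : exists P : (R -> 'rV[R]_n) -> (R -> 'rV[R]_n),
  forall g, continuous g -> P g 0 = 0 /\
    forall t : R, `|t| < 1 -> is_derive t 1 (P g) (g t).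
Proof.
have /choice[P0 HP0] : forall f : R -> R, exists G : R -> R, continuous f ->
    G 0 = 0 /\ forall t : R, `|t| < 1 -> is_derive t 1 G (f t).
  move=> f; have [cf|cf] := pselect (continuous f); last by exists f => /cf.
  by have [G HG] := antiderivative_exists cf; exists G.
exists (fun g t => \row_j P0 (fun s => g s 0 j) t) => g cg.
have cgj j : continuous (fun s => g s 0 j).
  move=> s; apply: (@continuous_comp _ _ _ g (fun M : 'rV[R]_n => M 0 j)).
    exact: cg.
  exact: coord_continuous.
split; first by apply/rowP => j; rewrite !mxE (HP0 _ (cgj j)).1.
move=> t t1; apply/is_derive_mxP => i j; rewrite (ord1 i).
under eq_fun do rewrite mxE.
exact: (HP0 _ (cgj j)).2.
Qed.

Lemma derive_bound_rV n (D d : R -> 'rV[R]_n) (c t : R) : `|t| < 1 -> 0 <= c ->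
  (forall s : R, `|s| < 1 -> is_derive s 1 D (d s)) ->
  (forall s, `|s| <= `|t| -> `|d s| <= c) -> `|D t - D 0| <= c * `|t|.
Proof.
move=> t1 c0 dD dc; apply: norm_le_coord => [|i j]; first exact: mulr_ge0.
rewrite !mxE; apply: (@derive_bound_real (fun s => D s i j) (fun s => d s i j)) => //.
  by move=> s /dD /is_derive_mxP; exact.
by move=> s /dc; apply: le_trans; exact: coord_le_norm.
Qed.

Lemma continuous_mulmx (T : topologicalType) m n p (A : T -> 'M[R]_(m, n))
  (B : T -> 'M[R]_(n, p)) t :
  {for t, continuous A} -> {for t, continuous B} ->
  {for t, continuous (fun s => A s *m B s)}.
Proof.
have cMij m' n' (M : T -> 'M[R]_(m', n')) i j : {for t, continuous M} ->
    M s i j @[s --> t] --> M t i j.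
  move=> cM; apply: (@continuous_comp _ _ _ M (fun N : 'M[R]_(m', n') => N i j)) => //.
  exact: coord_continuous.
move=> cA cB; apply/cvgrPdist_le => e e0.
have H ij : \forall s \near t,
    `|(A t *m B t) ij.1 ij.2 - (A s *m B s) ij.1 ij.2| <= e.
  have : (A s *m B s) ij.1 ij.2 @[s --> t] --> (A t *m B t) ij.1 ij.2.
    rewrite mxE; under eq_fun do rewrite mxE.
    by apply: cvg_big => [|k _]; [exact: add_continuous|]; apply: cvgM; exact: cMij.
  by move/cvgrPdist_le; exact.
near=> s; apply: norm_le_coord => [|i j]; first exact: ltW.
rewrite mxE [X in _ + X]mxE.
have : forall ij, `|(A t *m B t) ij.1 ij.2 - (A s *m B s) ij.1 ij.2| <= e.
  by near: s; apply: filter_forall => ij; exact: H.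
by move/(_ (i, j)).
Unshelve. all: by end_near. Qed.

(** Let w_k = 2K / 2^k, the sum of all steps from k on. The intervals [u_k - w_k, u_k + w_k] are
    nested, and the supremum of their left ends lies in each of them. *)
Lemma geometric_limit (u : nat -> R) (K : R) : 0 <= K ->
  (forall k, `|u k.+1 - u k| <= K / 2 ^+ k) ->
  exists l, forall k, `|u k - l| <= 2 * K / 2 ^+ k.
Proof.
move=> K0 Hu.
pose w k := 2 * K / 2 ^+ k.
have wS k : w k.+1 = K / 2 ^+ k.
  by rewrite /w exprS invfM mulrACA mulfV // mul1r.
have w2 k : w k = 2 * (K / 2 ^+ k) by rewrite /w mulrA.
have w0 k : 0 <= w k by rewrite /w !mulr_ge0 // invr_ge0 exprn_ge0.
have a_homo : {homo (fun k => u k - w k) : j k / (j <= k)%N >-> j <= k}.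
  apply: homo_leq => [x|y x z|k]; [exact: lexx|exact: le_trans|].
  have := Hu k; rewrite ler_norml wS w2 => /andP[]; lra.
have b_homo : {homo (fun k => u k + w k) : j k / (j <= k)%N >-> k <= j}.
  apply: homo_leq => [x|y x z|k]; [exact: lexx|by move=> xy yz; exact: le_trans yz xy|].
  have := Hu k; rewrite ler_norml wS w2 => /andP[]; lra.
have ab j k : u j - w j <= u k + w k.
  have := a_homo _ _ (leq_maxl j k); have := b_homo _ _ (leq_maxr j k).
  have := w0 (maxn j k); lra.
pose S : set R := [set x | exists k, x = u k - w k].
have Sub k : ubound S (u k + w k) by move=> _ [j ->].
have SS : has_sup S by split; [exists (u 0 - w 0); exists 0|exists (u 0 + w 0)].
exists (sup S) => k; rewrite -/(w k) ler_norml; apply/andP; split.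
- have : sup S <= u k + w k by apply: ge_sup; [exact: SS.1|exact: Sub].
  lra.
- have : u k - w k <= sup S by apply: sup_upper_bound => //; exists k.
  lra.
Qed.

(* Picard iteration. The coefficients are composed with the retraction onto
   [-e, e] to make them bounded and continuous on the whole line, and e is small
   enough for the iteration to halve distances. *)
Lemma linear_ode n (A : R -> 'M[R]_n) (e0 : R) (v : 'rV[R]_n) : 0 < e0 ->
  (forall t : R, `|t| < e0 -> {for t, continuous A}) ->
  exists e (V : R -> 'rV[R]_n), [/\ 0 < e, e <= e0, V 0 = v &
    forall t : R, `|t| < e -> is_derive t 1 V (V t *m A t)].
Proof.
move=> e0gt0 cA.
pose C := `|A 0| + 1.
have C0 : 0 <= C by rewrite addr_ge0.
have [d d0 Hd] : exists2 d : R, 0 < d & forall t, `|t| < d -> `|A t| <= C.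
  have : {for 0, continuous A} by apply: cA; rewrite normr0.
  move/cvgrPdist_le => /(_ 1 ltr01) /nbhs_ballP[d /= d0 H].
  exists d => // t td; have /H : ball (0 : R) d t by rewrite /ball /= sub0r normrN.
  move=> /= Hle; rewrite /C addrC -lerBlDr; apply: le_trans Hle.
  by rewrite distrC lerB_dist.
(* From e <= 1/L follow both e < 1, the range where the antiderivatives are valid, and n C e <= 1/2,
   the contraction factor; the n comes from [norm_mulmx]. *)
pose L := 2 * (n%:R * C) + 2.
have nC0 : 0 <= n%:R * C by rewrite mulr_ge0.
have L2 : 2 <= L by rewrite /L; lra.
have L0 : 0 < L by lra.
pose e := Num.min (Num.min (e0 / 2) (d / 2)) (L^-1).
have egt0 : 0 < e by rewrite !lt_min invr_gt0 L0 !divr_gt0.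
have ee0 : e <= e0 / 2 by rewrite !ge_min lexx.
have ed : e <= d / 2 by rewrite !ge_min lexx orbT.
have eL : e <= L^-1 by rewrite !ge_min lexx orbT.
have eL1 : e * L <= 1 by rewrite -ler_pdivlMr // mul1r.
have e1 : e < 1 by nra.
have enC : n%:R * C * e <= 1 / 2 by rewrite /L in eL1; nra.
pose clamp (t : R) : R := Num.max (- e) (Num.min e t).
have clamp_norm t : `|clamp t| <= e.
  rewrite ler_norml /clamp le_max lexx /= ge_max ge_min lexx /= andbT; lra.
have clampE t : `|t| <= e -> clamp t = t.
  by rewrite ler_norml => /andP[h1 h2]; rewrite /clamp min_r // max_r.
have clamp1 t : `|clamp t| < 1 by exact: le_lt_trans e1.
have cclamp : continuous clamp.
  move=> t; apply: (@continuous_max _ _ (cst (- e)) ((cst e) \min id)).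
    exact: cst_continuous.
  by apply: continuous_min => //; exact: cst_continuous.
pose B t := A (clamp t).
have cB : continuous B.
  move=> t; apply: (@continuous_comp _ _ _ clamp A); first exact: cclamp.
  by apply: cA; apply: le_lt_trans (clamp_norm t) _; lra.
have HB t : `|B t| <= C.
  by apply: Hd; apply: le_lt_trans (clamp_norm t) _; lra.
have [P HP] := antiderivative_rV n.
(* The Picard map. Clamping the upper limit too makes the estimates uniform over the whole line. *)
pose T (W : R -> 'rV[R]_n) t := v + P (fun s => W s *m B s) (clamp t).
have cWB (W : R -> 'rV[R]_n) : continuous W -> continuous (fun s => W s *m B s).
  by move=> cW s; apply: continuous_mulmx; [exact: cW|exact: cB].
have cT (W : R -> 'rV[R]_n) : continuous W -> continuous (T W).
  move=> cW t; apply: cvgD; first exact: cst_continuous.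
  apply: (@continuous_comp _ _ _ clamp (P (fun s => W s *m B s))); first exact: cclamp.
  apply: differentiable_continuous; apply/derivable1_diffP.
  by have [_ /(_ (clamp t) (clamp1 t))[]] := HP _ (cWB _ cW).
have Tcontr (W1 W2 : R -> 'rV[R]_n) (K : R) : continuous W1 -> continuous W2 -> 0 <= K ->
    (forall s, `|W1 s - W2 s| <= K) -> forall t, `|T W1 t - T W2 t| <= K / 2.
  move=> c1 c2 K0 HK t.
  have [P10 dP1] := HP _ (cWB _ c1); have [P20 dP2] := HP _ (cWB _ c2).
  pose D s := P (fun s => W1 s *m B s) s - P (fun s => W2 s *m B s) s.
  have -> : T W1 t - T W2 t = D (clamp t) - D 0.
    by rewrite /D P10 P20 subrr subr0 /T opprD addrACA subrr add0r.
  apply: le_trans (_ : n%:R * (K * C) * `|clamp t| <= _); last first.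
    have := clamp_norm t; have : 0 <= `|clamp t| by [].
    move: `|clamp t| => c c0 ce; rewrite (mulrC K) !mulrA mulrAC [X in _ <= X]mulrC.
    rewrite ler_wpM2r //; nra.
  apply: (@derive_bound_rV _ D (fun s => (W1 s - W2 s) *m B s)) => //.
  - by rewrite !mulr_ge0.
  - move=> s s1; rewrite mulmxBl.
    by apply: is_deriveB; [exact: dP1|exact: dP2].
  - move=> s _; apply: le_trans (norm_mulmx _ _) _.
    by rewrite ler_wpM2l // ler_pM.
pose Vk k := iter k T (cst v).
have cVk k : continuous (Vk k).
  by elim: k => [|k IH]; [exact: cst_continuous|exact: cT].
have [K0 K00 HK0] : exists2 K0 : R, 0 <= K0 & forall t, `|Vk 1%N t - Vk 0%N t| <= K0.
  exists (n%:R * (`|v| * C)); first by rewrite !mulr_ge0.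
  move=> t; have [P0 dP] := HP _ (cWB _ (cVk 0%N)).
  rewrite /Vk /= /T /= addrAC subrr add0r.
  rewrite -[X in `|X|]subr0 -P0.
  apply: le_trans (@derive_bound_rV _ _ (fun s => v *m B s)
     (n%:R * (`|v| * C)) _ _ _ dP _) _ => //.
  - by rewrite !mulr_ge0.
  - move=> s _; apply: le_trans (norm_mulmx _ _) _.
    by rewrite ler_wpM2l // ler_wpM2l.
  - by rewrite ler_piMr ?mulr_ge0 // ltW.
have HVk k : forall t, `|Vk k.+1 t - Vk k t| <= K0 / 2 ^+ k.
  elim: k => [|k IH] t; first by rewrite expr0 divr1.
  rewrite exprSr invfM mulrA.
  apply: (Tcontr (Vk k.+1) (Vk k) _ (cVk _) (cVk _) _ IH).
  by rewrite divr_ge0 // exprn_ge0.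
(* The limit is taken entry by entry, but at a rate independent of t: this uniformity makes [V]
   continuous and, with [Tcontr], a fixed point of [T]. *)
have Hlim t j : exists l, forall k, `|Vk k t 0 j - l| <= 2 * K0 / 2 ^+ k.
  apply: geometric_limit => // k; apply: le_trans (HVk k t).
  by apply: le_trans (coord_le_norm _ 0 j); rewrite !mxE.
pose V t : 'rV[R]_n := \row_j sval (cid (Hlim t j)).
have HV k t : `|Vk k t - V t| <= 2 * K0 / 2 ^+ k.
  apply: norm_le_coord => [|i j]; first by rewrite !mulr_ge0 // invr_ge0 exprn_ge0.
  by rewrite (ord1 i) !mxE; case: cid => l /= /(_ k).
have small (x : R) : 0 < x -> exists k, 2 * K0 / 2 ^+ k <= x.
  move=> x0; have [k Hk] : exists k, (2 * K0 / x) <= k%:R.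
    exists (Num.truncn (2 * K0 / x)).+1; apply: ltW; exact: truncnS_gt.
  exists k; rewrite ler_pdivrMr ?exprn_gt0 // [x * _]mulrC -ler_pdivrMr //.
  apply: le_trans Hk _; rewrite -natrX ler_nat ltnW //; exact: ltn_expl.
have cV : continuous V.
  move=> t; apply/cvgrPdist_le => x x0.
  have x30 : 0 < x / 3 by rewrite divr_gt0.
  have [k Hk] := small _ x30.
  have /cvgrPdist_le/(_ _ x30) := cVk k t; apply: filterS => s Hs.
  have -> : V t - V s = (V t - Vk k t) + (Vk k t - Vk k s) + (Vk k s - V s).
    by rewrite !addrA !subrK.
  have h1 : `|V t - Vk k t| <= x / 3 by rewrite distrC; apply: le_trans Hk.
  have h2 : `|Vk k s - V s| <= x / 3 by apply: le_trans Hk.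
  have := ler_normD (V t - Vk k t + (Vk k t - Vk k s)) (Vk k s - V s).
  have := ler_normD (V t - Vk k t) (Vk k t - Vk k s).
  lra.
have VT t : V t = T V t.
  apply/eqP; rewrite -subr_eq0 -normr_le0; apply/ler_addgt0Pr => x x0.
  rewrite add0r; have x20 : 0 < x / 2 by rewrite divr_gt0.
  have [k Hk] := small _ x20.
  have h1 := HV k.+1 t.
  have h2 : `|Vk k.+1 t - T V t| <= 2 * K0 / 2 ^+ k / 2.
    apply: (Tcontr (Vk k) V _ (cVk _) cV _ (HV k)).
    by rewrite !mulr_ge0 // invr_ge0 exprn_ge0.
  have -> : V t - T V t = (V t - Vk k.+1 t) + (Vk k.+1 t - T V t).
    by rewrite addrA subrK.
  apply: le_trans (ler_normD _ _) _; rewrite distrC.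
  rewrite exprSr invfM mulrA in h1.
  move: (2 * K0 / 2 ^+ k) Hk h1 h2 => y; lra.
have [P0 dP] := HP _ (cWB _ cV).
exists e, V; split=> //; first by lra.
  by rewrite VT /T clampE ?normr0 ?ltW // P0 addr0.
move=> t te; have t1 : `|t| < 1 by exact: lt_trans e1.
have -> : V t *m A t = 0 + V t *m B t by rewrite add0r /B clampE // ltW.
apply: (@near_eq_is_derive _ _ _ (fun s => v + P (fun s => V s *m B s) s)).
  have : \forall s \near t, `|s| < e.
    have : open [set s : R | `|s| < e].
      rewrite (_ : [set s | _] = (fun s : R => `|s|) @^-1` [set x | x < e]) //.
      by apply: open_comp; [move=> s _; exact: norm_continuous|exact: open_lt].
    by move=> oe; exact: (open_nbhs_nbhs (conj oe te)).
  by apply: filterS => s se; rewrite VT /T clampE // ltW.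
by apply: is_deriveD; exact: dP.
Qed.

(** Bootstrap: if [V] has order k, so does [V *m A], which is its derivative. *)
Lemma linear_ode_Ck n (A : R -> 'M[R]_n) (V : R -> 'rV[R]_n) 
    (U : set R) k :
  open U -> (forall k, Ck k U A) ->
  (forall t : R, U t -> is_derive t 1 V (V t *m A t)) -> Ck k U V.
Proof.
move=> oU cA dV.
have dfV t : U t -> differentiable V t.
  by move=> /dV[dVt _]; apply/derivable1_diffP.
elim: k => [|k IH]; split=> // v.
apply: (@Ck_ext _ _ _ _ _ (fun t => v *: (V t *m A t))) => //.
  move=> t Ut; have [_ <-] := dV _ Ut.
  rewrite !deriveE; [|exact: dfV..].
  by rewrite -[in RHS](mulr1 v) linearZ.
apply: Ck_mx => // i j.
apply: (@Ck_ext _ _ _ _ _ (fun t => v * (V t *m A t) i j)) => //.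
  by move=> t _; rewrite [RHS]mxE.
apply: CkM => //; first exact: Ck_cst.
by apply: Ck_coord => //; exact: Ck_mulmx.
Qed.

End LinearODE.

(** * Charts *)

Lemma row_jacobian (R : realType) m n (f : 'rV[R]_m -> 'rV[R]_n) p i :
  differentiable f p -> row i (jacobian f p) = 'D_(delta_mx 0 i) f p.
Proof. by move=> df; rewrite rowE -(deriveEjacobian _ df). Qed.

(* Failed conversions between derivatives would otherwise unfold them down to
   limits of filters and diverge. *)
#[local] Opaque jacobian derive.

Section Jacobian.
Variable R : realType.

Lemma jacobian_entry m n (f : 'rV[R]_m -> 'rV[R]_n) p i j :
  differentiable f p -> jacobian f p i j = 'D_(delta_mx 0 i) f p 0 j.
Proof. by move=> df; rewrite -(row_jacobian _ df) [RHS]mxE. Qed.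

Lemma jacobian_comp m n p (f : 'rV[R]_m -> 'rV[R]_n) (g : 'rV[R]_n -> 'rV[R]_p) x :
  differentiable f x -> differentiable g (f x) ->
  jacobian (g \o f) x = jacobian f x *m jacobian g (f x).
Proof.
move=> df dg; apply/row_matrixP => i.
have dgf : differentiable (g \o f) x by exact: differentiable_comp.
rewrite (row_jacobian _ dgf) derive_comp // row_mul (row_jacobian _ df).
exact: deriveEjacobian.
Qed.

Lemma near_eq_jacobian m n (f g : 'rV[R]_m -> 'rV[R]_n) x :
  {near x, f =1 g} -> differentiable f x -> jacobian f x = jacobian g x.
Proof.
move=> fg df; apply/row_matrixP => i.
have dg := near_eq_differentiable fg df.
apply: etrans (row_jacobian i df) _.
apply: etrans _ (esym (row_jacobian i dg)).
apply: near_eq_derive.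
exact: fg.
Qed.

Lemma Ck_jacobian k m n (U : set 'rV[R]_m) (f : 'rV[R]_m -> 'rV[R]_n) :
  open U -> Ck k.+1 U f -> Ck k U (jacobian f).
Proof.
move=> oU cf; apply: Ck_mx => // i j.
apply: (@Ck_ext _ _ _ _ _ (fun x => 'D_(delta_mx 0 i) f x 0 j)) => //.
  by move=> x Ux; rewrite jacobian_entry //; exact: cf.1.
by apply: Ck_coord => //; exact: cf.2.
Qed.

Lemma jacobian_id n (p : 'rV[R]_n) : jacobian id p = 1%:M.
Proof.
by apply/row_matrixP => i; rewrite row_jacobian // derive_id row1.
Qed.

End Jacobian.

Section Charts.
Variables (R : realType) (n : nat) (M : manifold R n).
Implicit Types (c d : chart R n M) (x : M).

Lemma cmapK_dom c x : charts M c -> cdom c x -> cinv c (cmap c x) = x.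
Proof. by move=> cc cx; apply: cmapK => //; rewrite inE. Qed.

Lemma cmap_image c p : charts M c -> (cmap c @` cdom c) p ->
  cdom c (cinv c p) /\ cmap c (cinv c p) = p.
Proof. by move=> cc [x cx <-]; rewrite cmapK_dom. Qed.

(** Turns a direct image into a preimage under [cinv c], to which continuity of the inverse chart
    applies. *)
Lemma cmap_imageE c U : charts M c -> 
  cmap c @` (cdom c `&` U) = (cmap c @` cdom c) `&` cinv c @^-1` U.
Proof.
move=> cc; apply/seteqP; split=> [_ [x [cx Ux] <-]|p [cp Up]].
  by split; [exists x|rewrite /preimage /= cmapK_dom].
by have [h1 h2] := cmap_image cc cp; exists (cinv c p).
Qed.

Lemma open_cmap c U : charts M c -> open U -> open (cmap c @` (cdom c `&` U)).
Proof.
move=> cc oU; rewrite cmap_imageE // openE => p [cp Up].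
apply: filterI; first exact: (open_nbhs_nbhs (conj (open_cimg cc) cp)).
by apply: cinv_continuous => //; [rewrite inE|exact: (open_nbhs_nbhs (conj oU Up))].
Qed.

Lemma near_cinv c x U : charts M c -> cdom c x -> open U -> U x ->
  \forall p \near cmap c x, (cmap c @` (cdom c `&` U)) p.
Proof.
move=> cc cx oU Ux; apply: (open_nbhs_nbhs (conj (open_cmap cc oU) _)).
by exists x.
Qed.

(** The cocycle of the tangent bundle; [jac_to] and [jac_from] are the cases where one of the two
    charts is [chart_at M x]. *)
Definition transition_jac c d x := jacobian (cmap d \o cinv c) (cmap c x).
Local Notation J := transition_jac.

Lemma differentiable_transition c d x : charts M c -> charts M d ->
  cdom c x -> cdom d x -> differentiable (cmap d \o cinv c) (cmap c x).
Proof.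
by move=> cc cd cx dx; apply: (chart_compat cc cd [::]); exists x.
Qed.

Lemma transition_jac_mul c d e x : charts M c -> charts M d -> charts M e ->
  cdom c x -> cdom d x -> cdom e x -> J c d x *m J d e x = J c e x.
Proof.
move=> cc cd ce cx dx ex.
have dcd := differentiable_transition cc cd cx dx.
have dde := differentiable_transition cd ce dx ex.
have pE : (cmap d \o cinv c) (cmap c x) = cmap d x by rewrite /= cmapK_dom.
rewrite -pE in dde; have := jacobian_comp dcd dde; rewrite pE => E1.
apply: etrans (esym E1) _; apply: near_eq_jacobian.
  apply: filterS (near_cinv cc cx (open_cdom cd) dx) => _ [y [cy dy] <-] /=.
  by rewrite !cmapK_dom.
exact: differentiable_comp.
Qed.

Lemma transition_jac_id c x : charts M c -> cdom c x -> J c c x = 1%:M.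
Proof.
move=> cc cx; apply: etrans (jacobian_id (cmap c x)).
apply: near_eq_jacobian; last exact: differentiable_transition.
apply: filterS (near_cinv cc cx (open_cdom cc) cx) => _ [y [cy _] <-] /=.
by rewrite !cmapK_dom.
Qed.

Lemma jac_toE c x : jac_to M c x = J (chart_at M x) c x.
Proof. by []. Qed.

Lemma jac_fromE c x : jac_from M c x = J c (chart_at M x) x.
Proof. by []. Qed.

Lemma jac_toK c x : charts M c -> cdom c x -> jac_to M c x *m jac_from M c x = 1%:M.
Proof.
have ca := chart_at_charts x; have cx := chart_at_dom x.
by move=> cc cx'; rewrite jac_toE jac_fromE transition_jac_mul ?transition_jac_id.
Qed.

Lemma Ck_transition_jac k c d : charts M c -> charts M d ->
  Ck k (cmap c @` (cdom c `&` cdom d)) (fun p => J c d (cinv c p)).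
Proof.
move=> cc cd; have oU := open_cmap cc (open_cdom cd).
apply: (@Ck_ext _ _ _ _ _ (jacobian (cmap d \o cinv c))).
- exact: oU.
- move=> _ [x [cx dx] <-].
  by rewrite /J (cmapK_dom cc cx).
by apply: Ck_jacobian => //; move/smooth_onP: (chart_compat cc cd); exact.
Qed.

Lemma derive_in_chart c x (f : M -> R) (U : set M) w : charts M c -> cdom c x ->
  open U -> U x -> smooth_fun M U f ->
  'D_w (f \o cinv c) (cmap c x) = (w *m jac_from M c x *m differential M f x) 0 0.
Proof.
move=> cc cx oU Ux sf.
have ca := chart_at_charts x; have ax := chart_at_dom x.
set a := chart_at M x in ca ax *.
have df e : charts M e -> cdom e x -> differentiable (f \o cinv e) (cmap e x).
  by move=> ce ex; apply: (sf e ce [::]); exists x.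
have E u : 'D_u (f \o cinv a) (cmap a x) = (u *m differential M f x) 0 0.
  rewrite derive_rV; last exact: df.
  by rewrite mxE; apply: eq_bigr => i _; rewrite mxE.
rewrite -E.
have dt := differentiable_transition cc ca cx ax.
transitivity ('D_w ((f \o cinv a) \o (cmap a \o cinv c)) (cmap c x)).
  apply: near_eq_derive.
  apply: filterS (near_cinv cc cx (open_cdom ca) ax) => _ [y [cy ay] <-] /=.
  by rewrite !cmapK_dom.
have cE : (cmap a \o cinv c) (cmap c x) = cmap a x by rewrite /= cmapK_dom.
rewrite (@derive_comp _ _ _ _ (f \o cinv a) (cmap a \o cinv c)) ?cE //; last exact: df.
by rewrite deriveEjacobian.
Qed.

(** The factor [jac_from M c] in [form_rep] cancels the pointwise choice of chart made by
    [differential]: what remains are the partial derivatives of [f \o cinv c]. *)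
Lemma smooth_form_differential (f : M -> R) :
  smooth_fun M setT f -> smooth_form M setT (differential M f).
Proof.
move=> sf c cc; have oT := open_cmap cc openT.
apply/smooth_onP => k.
have cf := (smooth_onP _ _).1 (sf c cc).
apply: (@Ck_ext _ _ _ _ _ (fun p => \col_i 'D_(delta_mx 0 i) (f \o cinv c) p)) => //.
  move=> _ [x [cx _] <-]; apply/colP => i; rewrite mxE /form_rep cmapK_dom //.
  rewrite (@derive_in_chart _ _ _ setT) //; last exact: openT.
  by rewrite -mulmxA -rowE mxE.
apply: Ck_mx => // i j.
apply: (@Ck_ext _ _ _ _ _ ('D_(delta_mx 0 i) (f \o cinv c))) => //.
  by move=> p _; rewrite mxE.
by have [_] := cf k.+1; exact.
Qed.

(* A bump function in a chart extends by 0 because the image of a closed ball of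
   the chart is compact, hence closed in the Hausdorff space M. *)
Lemma exists_differential x (a : 'cV[R]_n) :
  exists2 f : M -> R, smooth_fun M setT f & differential M f x = a.
Proof.
have cc := chart_at_charts x; have cx := chart_at_dom x.
set c := chart_at M x in cc cx *.
have [r r0 Hr] : exists2 r, 0 < r & forall q, `|q - cmap c x| <= r ->
    (cmap c @` cdom c) q.
  have : nbhs (cmap c x) (cmap c @` cdom c).
    by apply: (open_nbhs_nbhs (conj (open_cimg cc) _)); exists x.
  move=> /nbhs_ballP[e /= e0 He]; exists (e / 2); first by rewrite divr_gt0.
  move=> q qe; apply: He; rewrite -ball_normE /= distrC.
  by apply: le_lt_trans qe _; rewrite ltr_pdivrMr // ltr_pMr // ltr1n.
have [g [sg Dg g0]] := bump_exists (cmap c x) a r0.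
pose K := cinv c @` [set q | `|q - cmap c x| <= r].
have cK : compact K.
  apply: continuous_compact.
    apply: continuous_in_subspaceT => q; rewrite inE /= => qr.
    by apply: cinv_continuous => //; rewrite inE; exact: Hr.
  apply: bounded_closed_compact.
    exists (r + `|cmap c x|); split; first exact: num_real.
    move=> z rz q /= qr; apply: ltW; apply: le_lt_trans rz.
    rewrite -[q in leLHS](subrK (cmap c x)).
    by apply: le_trans (ler_normD _ _) _; rewrite lerD2r.
  have cdist : continuous (fun q : 'rV[R]_n => `|q - cmap c x|).
    move=> q; apply: continuous_comp; last exact: norm_continuous.
    exact: (@cvgB _ _ _ (nbhs q) _ id (cst (cmap c x)) q _ (@cvg_id _ _) (@cvg_cst _ _ _ _ _)).
  have -> : [set q | `|q - cmap c x| <= r] =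
      (fun q => `|q - cmap c x|) @^-1` [set y | y <= r] by [].
  apply: preimage_closed; last exact: closed_le.
  by move=> q _; exact: cdist.
have Kclosed : closed K by apply: compact_closed cK; exact: manifold_hausdorff.
have Kdom y : K y -> cdom c y.
  by move=> [q /Hr cq <-]; have [] := cmap_image cc cq.
pose f y := if pselect (cdom c y) then g (cmap c y) else 0.
have fdom y : cdom c y -> f y = g (cmap c y) by rewrite /f; case: pselect.
have fK y : ~ K y -> f y = 0.
  move=> nK; rewrite /f; case: pselect => // cy; apply: g0.
  rewrite leNgt; apply/negP => lt; apply: nK; exists (cmap c y) => /=.
    exact: ltW.
  by rewrite cmapK_dom.
exists f.
  move=> d cd; apply/smooth_onP => k.
  have oD := open_cmap cd openT.
  have oDc := open_cmap cd (open_cdom cc).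
  have oDK := open_cmap cd (closed_openC Kclosed).
  (* The open sets [cdom c] and the complement of [K] cover M; [f] is the bump read through a
     transition map on the first and 0 on the second. *)
  have cDc : Ck k (cmap d @` (cdom d `&` cdom c)) (f \o cinv d).
    apply: (@Ck_ext _ _ _ _ _ (g \o (cmap c \o cinv d))) => //.
      by move=> _ [y [dy cy] <-] /=; rewrite cmapK_dom // fdom.
    apply: (@Ck_comp_real _ _ _ _ _ setT) => //.
      by move/smooth_onP: sg; exact.
    by move/smooth_onP: (chart_compat cd cc); exact.
  have cDK : Ck k (cmap d @` (cdom d `&` ~` K)) (f \o cinv d).
    apply: (@Ck_ext _ _ _ _ _ (fun=> 0)) => //; last exact: Ck_cst.
    by move=> _ [y [dy cy] <-] /=; rewrite cmapK_dom // fK.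
  apply: Ck_sub (CkU cDc cDK) => _ [y [dy _] <-].
  have [cy|cy] := pselect (cdom c y); [left|right]; exists y; split=> //.
  by move/Kdom.
apply/colP => i; rewrite mxE /dirder -/c.
rewrite (@near_eq_derive _ _ _ _ g).
  by rewrite Dg -rowE mxE.
apply: filterS (near_cinv cc cx openT I) => _ [y [cy _] <-] /=.
by rewrite cmapK_dom // fdom.
Qed.

End Charts.

(** * Smooth maps, fields and connections *)

Section MatrixDerivative.
Variables (R : realType) (V : normedModType R).

Lemma derive_mulmx m n p (f : V -> 'M[R]_(m, n)) (g : V -> 'M[R]_(n, p)) x v :
  differentiable f x -> differentiable g x ->
  'D_v (fun y => f y *m g y) x = 'D_v f x *m g x + f x *m 'D_v g x.
Proof.
move=> df dg.
have dfij i j : derivable (fun y => f y i j) x v.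
  by have /derivable_mxP := diff_derivable (v:=v) df; exact.
have dgij i j : derivable (fun y => g y i j) x v.
  by have /derivable_mxP := diff_derivable (v:=v) dg; exact.
have H i j : is_derive x v (fun y => (f y *m g y) i j)
    (('D_v f x *m g x + f x *m 'D_v g x) i j).
  have -> : (fun y => (f y *m g y) i j) = \sum_k ((fun y => f y i k) * (fun y => g y k j)).
    by apply/funext => y; rewrite mxE fct_sumE.
  have -> : ('D_v f x *m g x + f x *m 'D_v g x) i j =
      \sum_k (f x i k *: 'D_v g x k j + g x k j *: 'D_v f x i k).
    rewrite !mxE -big_split /=; apply: eq_bigr => k _.
    by rewrite addrC /GRing.scale /= [X in _ + X]mulrC.
  apply: is_derive_sum => k; apply: is_deriveM.
  - by apply: DeriveDef => //; exact: derive_coord.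
  - by apply: DeriveDef => //; exact: derive_coord.
by have [_ ->] := (is_derive_mxP _ _ _ _).2 H.
Qed.

Lemma derive_row_mx m n1 n2 (f : V -> 'M[R]_(m, n1)) (g : V -> 'M[R]_(m, n2)) x v :
  differentiable f x -> differentiable g x ->
  'D_v (fun y => row_mx (f y) (g y)) x = row_mx ('D_v f x) ('D_v g x).
Proof.
move=> df dg.
suff H i j : is_derive x v (fun y => row_mx (f y) (g y) i j)
    (row_mx ('D_v f x) ('D_v g x) i j).
  by have [_ ->] := (is_derive_mxP _ _ _ _).2 H.
case: (split_ordP j) => k ->.
  rewrite row_mxEl; under eq_fun do rewrite row_mxEl.
  apply: DeriveDef; last exact: derive_coord.
  by have /derivable_mxP := diff_derivable (v:=v) df; exact.
rewrite row_mxEr; under eq_fun do rewrite row_mxEr.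
apply: DeriveDef; last exact: derive_coord.
by have /derivable_mxP := diff_derivable (v:=v) dg; exact.
Qed.

End MatrixDerivative.

Section Submatrices.
Variable R : realType.

Lemma Ck_lsubmx k m n1 n2 (U : set 'M[R]_(m, n1 + n2)) : open U ->
  Ck k U (lsubmx : _ -> 'M[R]_(m, n1)).
Proof.
move=> oU; apply: Ck_mx => // i j.
apply: (@Ck_ext _ _ _ _ _ (fun q : 'M[R]_(m, n1 + n2) => q i (lshift n2 j))) => //.
  by move=> q _; rewrite mxE.
by apply: (@Ck_coord _ _ _ _ _ _ id) => //; exact: Ck_id.
Qed.

Lemma Ck_rsubmx k m n1 n2 (U : set 'M[R]_(m, n1 + n2)) : open U ->
  Ck k U (rsubmx : _ -> 'M[R]_(m, n2)).
Proof.
move=> oU; apply: Ck_mx => // i j.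
apply: (@Ck_ext _ _ _ _ _ (fun q : 'M[R]_(m, n1 + n2) => q i (rshift n1 j))) => //.
  by move=> q _; rewrite mxE.
by apply: (@Ck_coord _ _ _ _ _ _ id) => //; exact: Ck_id.
Qed.

Lemma derive_lsubmx m n1 n2 (q U : 'M[R]_(m, n1 + n2)) : 'D_U lsubmx q = lsubmx U.
Proof.
apply/matrixP => i j.
have d : differentiable (lsubmx : _ -> 'M[R]_(m, n1)) q.
  exact: (Ck_differentiable (Ck_lsubmx 0 openT)).
rewrite -(derive_coord _ _ _ d) [RHS]mxE.
have -> : (fun y : 'M[R]_(m, n1 + n2) => lsubmx y i j) = (fun y => y i (lshift n2 j)).
  by apply/funext => y; rewrite mxE.
by rewrite (@derive_coord _ _ _ _ id) // derive_id.
Qed.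

Lemma derive_rsubmx m n1 n2 (q U : 'M[R]_(m, n1 + n2)) : 'D_U rsubmx q = rsubmx U.
Proof.
apply/matrixP => i j.
have d : differentiable (rsubmx : _ -> 'M[R]_(m, n2)) q.
  exact: (Ck_differentiable (Ck_rsubmx 0 openT)).
rewrite -(derive_coord _ _ _ d) [RHS]mxE.
have -> : (fun y : 'M[R]_(m, n1 + n2) => rsubmx y i j) = (fun y => y i (rshift n1 j)).
  by apply/funext => y; rewrite mxE.
by rewrite (@derive_coord _ _ _ _ id) // derive_id.
Qed.

End Submatrices.

Section ChainRule.
Variables (R : realType) (n1 n2 : nat) (T1 T2 : Type).
Variables (A1 : atlas R n1 T1) (A2 : atlas R n2 T2).

(** Stated for bare atlases, with the needed chart properties as hypotheses, so as to serve both for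
    [F] and for its tangent map, whose source and target carry only a [tangent_atlas]. *)
Lemma differential_comp (F : T1 -> T2) (f : T2 -> R) (x : T1) :
  let a := chart_at A1 x in let b := chart_at A2 (F x) in
  cinv a (cmap a x) = x ->
  differentiable (cmap b \o F \o cinv a) (cmap a x) ->
  differentiable (f \o cinv b) (cmap b (F x)) ->
  (\forall p \near cmap a x, cinv b (cmap b (F (cinv a p))) = F (cinv a p)) ->
  differential A1 (f \o F) x = dmap A1 A2 F x *m differential A2 f (F x).
Proof.
move=> a b ax dF df nE; apply/colP => i.
have pE : (cmap b \o F \o cinv a) (cmap a x) = cmap b (F x) by rewrite /= ax.
rewrite -pE in df.
have -> : (dmap A1 A2 F x *m differential A2 f (F x)) i 0 =
    \sum_j ('D_(delta_mx 0 i) (cmap b \o F \o cinv a) (cmap a x)) 0 j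
      * 'D_(delta_mx 0 j) (f \o cinv b) (cmap b (F x)).
  rewrite mxE; apply: eq_bigr => j _; congr (_ * _); last by rewrite mxE.
  exact: jacobian_entry.
transitivity ('D_(delta_mx 0 i) (f \o F \o cinv a) (cmap a x)); first by rewrite mxE.
transitivity ('D_(delta_mx 0 i) ((f \o cinv b) \o (cmap b \o F \o cinv a)) (cmap a x)).
  by apply: near_eq_derive; apply: filterS nE => p /= ->.
by rewrite (derive_comp _ dF df) (derive_rV _ df) pE.
Qed.

End ChainRule.

Section SmoothMaps.
Variables (R : realType) (n1 n2 : nat).
Variables (M1 : manifold R n1) (M2 : manifold R n2) (F : M1 -> M2).
Hypothesis sF : smooth_map F.

Lemma open_preimage_cdom (d : chart R n2 M2) : charts M2 d -> open (F @^-1` cdom d).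
Proof. by move=> cd; apply: open_comp (open_cdom cd) => y _; exact: sF.1. Qed.

Lemma differentiable_rep (c : chart R n1 M1) (d : chart R n2 M2) x :
  charts M1 c -> charts M2 d -> cdom c x -> cdom d (F x) ->
  differentiable (cmap d \o F \o cinv c) (cmap c x).
Proof. by move=> cc cd cx dx; apply: (sF.2 c d cc cd [::]); exists x. Qed.

(** Chain rule through the preferred charts at x and [F x]. It replaces [dmap], whose charts move
    with x, by a Jacobian in fixed charts, which can be differentiated in x. *)
Lemma jacobian_rep (c : chart R n1 M1) (d : chart R n2 M2) x :
  charts M1 c -> charts M2 d -> cdom c x -> cdom d (F x) ->
  jacobian (cmap d \o F \o cinv c) (cmap c x) =
  jac_from M1 c x *m dmap M1 M2 F x *m jac_to M2 d (F x).
Proof.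
move=> cc cd cx dx.
have ca := chart_at_charts x; have ax := chart_at_dom x.
have cb := chart_at_charts (F x); have bx := chart_at_dom (F x).
rewrite /dmap jac_toE jac_fromE.
set a := chart_at M1 x in ca ax *; set b := chart_at M2 (F x) in cb bx *.
have d1 := differentiable_transition cc ca cx ax.
have d2 := differentiable_rep ca cb ax bx.
have d3 := differentiable_transition cb cd bx dx.
have p1 : (cmap a \o cinv c) (cmap c x) = cmap a x by rewrite /= cmapK_dom.
have p2 : (cmap b \o F \o cinv a) (cmap a x) = cmap b (F x) by rewrite /= cmapK_dom.
rewrite -p1 in d2; have E12 := jacobian_comp d1 d2.
have d12 := differentiable_comp d1 d2.
have p12 : ((cmap b \o F \o cinv a) \o (cmap a \o cinv c)) (cmap c x) = cmap b (F x).
  by rewrite /= !cmapK_dom.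
rewrite -p12 in d3; have E123 := jacobian_comp d12 d3.
have d123 := differentiable_comp d12 d3.
rewrite /transition_jac; apply: esym.
apply: etrans (_ : jacobian ((cmap d \o cinv b) \o
   ((cmap b \o F \o cinv a) \o (cmap a \o cinv c))) (cmap c x) = _).
  apply: esym; apply: etrans E123 _; rewrite p12; congr (_ *m _).
  by apply: etrans E12 _; rewrite p1.
apply: near_eq_jacobian d123.
have oU := openI (open_cdom ca) (open_preimage_cdom cb).
apply: filterS (near_cinv cc cx oU (conj ax bx)) => _ [y [cy [ay by_]] <-] /=.
by rewrite !cmapK_dom.
Qed.

Lemma differential_pullback (f : M2 -> R) x : smooth_fun M2 setT f ->
  differential M1 (f \o F) x = dmap M1 M2 F x *m differential M2 f (F x).
Proof.
move=> sf.
have ca := chart_at_charts x; have ax := chart_at_dom x.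
have cb := chart_at_charts (F x); have bx := chart_at_dom (F x).
apply: differential_comp.
- by rewrite cmapK_dom.
- exact: differentiable_rep.
- by apply: (sf _ cb [::]); exists (F x).
- apply: filterS (near_cinv ca ax (open_preimage_cdom cb) bx) => _ [y [ay by_] <-] /=.
  by rewrite !cmapK_dom.
Qed.

End SmoothMaps.

Section Fields.
Variables (R : realType) (n : nat) (M : manifold R n).
Local Notation J := (@transition_jac R n M).

Lemma smooth_vfD (U : set M) (X Y : vector_field M) : open U ->
  smooth_vf M U X -> smooth_vf M U Y -> smooth_vf M U (fun y => X y + Y y).
Proof.
move=> oU sX sY c cc; apply/smooth_onP => k; have oc := open_cmap cc oU.
apply: (@Ck_ext _ _ _ _ _ (fun p => vf_rep c X p + vf_rep c Y p)) => //.
  by move=> p _; rewrite /vf_rep mulmxDl.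
by apply: CkD => //; [move/smooth_onP: (sX c cc)|move/smooth_onP: (sY c cc)]; exact.
Qed.

Lemma smooth_vfZ (U : set M) (f : M -> R) (X : vector_field M) : open U ->
  smooth_fun M U f -> smooth_vf M U X -> smooth_vf M U (fun y => f y *: X y).
Proof.
move=> oU sf sX c cc; apply/smooth_onP => k; have oc := open_cmap cc oU.
apply: (@Ck_ext _ _ _ _ _ (fun p => (f \o cinv c) p *: vf_rep c X p)) => //.
  by move=> p _; rewrite /vf_rep scalemxAl.
by apply: Ck_scale => //; [move/smooth_onP: (sf c cc)|move/smooth_onP: (sX c cc)]; exact.
Qed.

Lemma smooth_vf0 (U : set M) : open U -> smooth_vf M U (fun=> 0).
Proof.
move=> oU c cc; apply/smooth_onP => k; have oc := open_cmap cc oU.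
apply: (@Ck_ext _ _ _ _ _ (fun=> 0)) => //; last exact: Ck_cst.
by move=> p _; rewrite /vf_rep mul0mx.
Qed.

Lemma smooth_vf_sum (U : set M) m (X : 'I_m -> vector_field M) (r : seq 'I_m) :
  open U -> (forall j, smooth_vf M U (X j)) ->
  smooth_vf M U (fun y => \sum_(j <- r) X j y).
Proof.
move=> oU sX; elim: r => [|j r IH].
  by under eq_fun do rewrite big_nil; exact: smooth_vf0.
by under eq_fun do rewrite big_cons; exact: smooth_vfD.
Qed.

Lemma transition_in_chart k (c d e : chart R n M) :
  charts M c -> charts M d -> charts M e ->
  Ck k (cmap e @` (cdom e `&` (cdom c `&` cdom d))) (fun p => J c d (cinv e p)).
Proof.
move=> cc cd ce; have oU := open_cmap ce (openI (open_cdom cc) (open_cdom cd)).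
apply: (@Ck_ext _ _ _ _ _ ((fun q => J c d (cinv c q)) \o (cmap c \o cinv e))); first exact: oU.
  move=> _ [y [ey [cy dy]] <-] /=.
  by rewrite (cmapK_dom ce ey) (cmapK_dom cc cy).
apply: (@Ck_comp _ _ _ _ _ _ _ (cmap c @` (cdom c `&` cdom d))).
- exact: oU.
- by apply: open_cmap => //; exact: open_cdom.
- move=> _ [y [ey [cy dy]] <-] /=; exists y => //.
  by rewrite !cmapK_dom.
- exact: Ck_transition_jac.
- apply: (@Ck_sub _ _ _ _ (cmap e @` (cdom e `&` cdom c))).
    by move=> _ [y [ey [cy dy]] <-]; exists y.
  by move/smooth_onP: (chart_compat ce cc); exact.
Qed.

Lemma const_field_rep (c d : chart R n M) w y : charts M c -> charts M d ->
  cdom c y -> cdom d y -> const_field M c w y *m jac_to M d y = w *m J c d y.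
Proof.
move=> cc cd cy dy; rewrite /const_field -mulmxA jac_toE jac_fromE.
by rewrite transition_jac_mul //; [exact: chart_at_charts|exact: chart_at_dom].
Qed.

Lemma smooth_const_field (c : chart R n M) w : charts M c ->
  smooth_vf M (cdom c) (const_field M c w).
Proof.
move=> cc d cd; apply/smooth_onP => k; have od := open_cmap cd (open_cdom cc).
apply: (@Ck_ext _ _ _ _ _ (fun p => w *m J c d (cinv d p))); first exact: od.
  move=> _ [y [dy cy] <-]; rewrite /vf_rep (cmapK_dom cd dy).
  by rewrite (const_field_rep w cc cd cy dy).
apply: (Ck_mulmx od); first exact: Ck_cst.
apply: Ck_sub (transition_in_chart k cc cd cd) => _ [y [dy cy] <-].
by exists y.
Qed.

Lemma smooth_transition_entry (c d : chart R n M) i j : charts M c -> charts M d ->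
  smooth_fun M (cdom c `&` cdom d) (fun z => J c d z i j).
Proof.
move=> cc cd e ce; apply/smooth_onP => k.
have oe := open_cmap ce (openI (open_cdom cc) (open_cdom cd)).
apply: (@Ck_coord _ _ _ _ _ _ (fun p => J c d (cinv e p))) => //.
exact: transition_in_chart.
Qed.

Lemma frame_change (c d : chart R n M) i z : charts M c -> charts M d ->
  cdom c z -> cdom d z -> frame M c i z = \sum_j J c d z i j *: frame M d j z.
Proof.
move=> cc cd cz dz.
have ca := chart_at_charts z; have az := chart_at_dom z.
rewrite /frame /const_field !jac_fromE -(transition_jac_mul cc cd ca cz dz az).
rewrite mulmxA -rowE; apply/rowP => l; rewrite [LHS]mxE summxE.
apply: eq_bigr => j _; rewrite -rowE.
by rewrite [X in X * _]mxE [RHS]mxE [X in _ = _ * X]mxE.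
Qed.

Lemma jac_from_id x : jac_from M (chart_at M x) x = 1%:M.
Proof.
by rewrite jac_fromE transition_jac_id //; [exact: chart_at_charts|exact: chart_at_dom].
Qed.

Lemma jac_to_id x : jac_to M (chart_at M x) x = 1%:M.
Proof.
by rewrite jac_toE transition_jac_id //; [exact: chart_at_charts|exact: chart_at_dom].
Qed.

Lemma dirder_chart (c : chart R n M) x (f : M -> R) (U : set M) w :
  charts M c -> cdom c x -> open U -> U x -> smooth_fun M U f ->
  dirder M f x (w *m jac_from M c x) = 'D_w (f \o cinv c) (cmap c x).
Proof.
move=> cc cx oU Ux sf; rewrite (derive_in_chart w cc cx oU Ux sf).
have ca := chart_at_charts x; have ax := chart_at_dom x.
by rewrite /dirder (derive_in_chart _ ca ax oU Ux sf) jac_from_id mulmx1.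
Qed.

End Fields.

Section Connection.
Variables (R : realType) (n : nat) (M : manifold R n) (D : connection M).
Local Notation J := (@transition_jac R n M).

Lemma nabla_sum (U : set M) m (f : 'I_m -> M -> R) (X : 'I_m -> vector_field M)
    (r : seq 'I_m) x u :
  open U -> U x -> (forall j, smooth_fun M U (f j)) -> (forall j, smooth_vf M U (X j)) ->
  nabla D (fun y => \sum_(j <- r) f j y *: X j y) x u =
  \sum_(j <- r) (dirder M (f j) x u *: X j x + f j x *: nabla D (X j) x u).
Proof.
move=> oU Ux sf sX; elim: r => [|j r IH].
  rewrite big_nil.
  have s0 := smooth_vf0 (M := M) oU.
  (* The derivative of the zero field vanishes because additivity, applied to 0 + 0, makes it equal
     to its double. *)
  have := nabla_add D oU s0 s0 Ux u.
  have -> : nabla D (fun y => \sum_(j <- [::]) f j y *: X j y) x u = nabla D (fun=> 0) x u.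
    apply: (nabla_local D oU) => // [|y _]; last by rewrite big_nil.
    by under eq_fun do rewrite big_nil.
  have -> : nabla D (fun=> 0 + 0) x u = nabla D (fun=> 0) x u.
    apply: (nabla_local D oU) => // [|y _]; last by rewrite addr0.
    by under eq_fun do rewrite addr0.
  by move/esym/eqP; rewrite -subr_eq0 addrK => /eqP.
rewrite big_cons -IH -(nabla_leibniz D oU (sf j) (sX j) Ux).
have sZ i := smooth_vfZ oU (sf i) (sX i).
rewrite -(nabla_add D oU (sZ j) (smooth_vf_sum r oU sZ) Ux).
have sS := smooth_vfD oU (sZ j) (smooth_vf_sum r oU sZ).
apply: esym; apply: (nabla_local D oU sS) => // y _.
by rewrite big_cons.
Qed.

Lemma nabla_frame_linear (c : chart R n M) j x : charts M c -> cdom c x ->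
  forall k u v, nabla D (frame M c j) x (k *: u + v) =
    k *: nabla D (frame M c j) x u + nabla D (frame M c j) x v.
Proof.
move=> cc cx k u v; apply: (nabla_linear D (open_cdom cc)) cx k u v.
exact: smooth_const_field.
Qed.

(** [lin1_mx] represents a map only if the map is linear; here linearity in the direction holds
    because coordinate frames are smooth on the domain of their chart. *)
Lemma mul_christoffel x u v :
  u *m christoffel D (x, v) =
  \sum_j v 0 j *: nabla D (frame M (chart_at M x) j) x u.
Proof.
have ca := chart_at_charts x; have ax := chart_at_dom x.
rewrite /christoffel /= mulmx_sumr; apply: eq_bigr => j _.
rewrite -scalemxAr; congr (_ *: _).
set g := nabla D (frame M (chart_at M x) j) x.
have glin : linear g by move=> k a b; exact: nabla_frame_linear.
pose gM := GRing.isLinear.Build _ _ _ _ g glin.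
pose gL : {linear 'rV[R]_n -> 'rV[R]_n} := HB.pack g gM.
by rewrite -[g]/(gL : _ -> _) mul_rV_lin1.
Qed.

(** The inhomogeneous transformation law of the Christoffel symbols: expand the frame of [c] over
    that of [a] and apply the Leibniz rule. At x the frame of [a] is the standard basis, so the
    derivatives of the coefficients assemble into a row of the derivative of the Jacobian. *)
Lemma nabla_frame_change (c : chart R n M) i x u : charts M c -> cdom c x ->
  let a := chart_at M x in
  nabla D (frame M c i) x (u *m jac_from M c x) =
  row i ('D_u (jacobian (cmap a \o cinv c)) (cmap c x)) +
  \sum_j J c a x i j *: nabla D (frame M a j) x (u *m jac_from M c x).
Proof.
move=> cc cx a.
have ca : charts M a := chart_at_charts x; have ax : cdom a x := chart_at_dom x.
have oU := openI (open_cdom cc) (open_cdom ca).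
have Ux : (cdom c `&` cdom a) x by [].
have sfr (d : chart R n M) j : charts M d -> (cdom c `&` cdom a `<=` cdom d) ->
    smooth_vf M (cdom c `&` cdom a) (frame M d j).
  move=> cd sub e ce; apply/smooth_onP => k.
  apply: (@Ck_sub _ _ _ _ (cmap e @` (cdom e `&` cdom d))).
    by move=> _ [y [ey /sub dy] <-]; exists y.
  by move/smooth_onP: (smooth_const_field (delta_mx 0 j) cd ce); exact.
have sJ i' j := @smooth_transition_entry R n M c a i' j cc ca.
have fcE : {in cdom c `&` cdom a, frame M c i =1
    (fun y => \sum_j J c a y i j *: frame M a j y)}.
  by move=> y; rewrite inE => -[cy ay]; exact: frame_change.
apply: etrans (nabla_local D oU (sfr c i cc (@subIsetl _ _ _)) fcE Ux _) _.
rewrite (nabla_sum _ _ oU Ux (sJ i) (fun j => sfr a j ca (@subIsetr _ _ _))).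
rewrite big_split /=; congr (_ + _).
have dJ : differentiable (jacobian (cmap a \o cinv c)) (cmap c x).
  have oV := open_cmap cc (open_cdom ca).
  apply: (@Ck_differentiable _ 0 _ _ (cmap c @` (cdom c `&` cdom a))); last by exists x.
  by apply: Ck_jacobian => //; move/smooth_onP: (chart_compat cc ca); exact.
apply/rowP => l; rewrite summxE (bigD1 l) //= big1 => [|j jl]; last first.
  rewrite mxE /frame /const_field jac_from_id mulmx1 [X in _ * X]mxE.
  by rewrite eq_sym (negbTE jl) andbF mulr0.
rewrite addr0 mxE /frame /const_field jac_from_id mulmx1 [X in _ * X]mxE !eqxx mulr1.
rewrite (dirder_chart _ cc cx oU Ux (sJ i l)) [RHS]mxE -(derive_coord _ _ _ dJ).
apply: near_eq_derive.
apply: filterS (near_cinv cc cx (open_cdom ca) ax) => _ [y [cy ay] <-].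
by rewrite /transition_jac /= (cmapK_dom cc cy).
Qed.

End Connection.

(** * Parallel transport and affine maps *)

Section Line.
Variables (R : realType) (n : nat).
Definition line (p u : 'rV[R]_n) (t : R) : 'rV[R]_n := t *: u + p.

Lemma Ck_line k (U : set R) p u : open U -> Ck k U (line p u).
Proof.
move=> oU; apply: CkD => //; last exact: Ck_cst.
by apply: (@CkZl _ _ _ _ _ id) => //; exact: Ck_id.
Qed.

Lemma differentiable_line p u (t : R) : differentiable (line p u) t.
Proof. exact: (Ck_differentiable (Ck_line 0 p u openT)). Qed.

Lemma derive_line p u (t : R) : 'D_1 (line p u) t = u.
Proof.
rewrite -[RHS]addr0 /line.
have -> : 'D_1 (fun t : R => t *: u + p) t = 'D_1 ((fun t : R => t *: u) + cst p) t by [].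
have d1 : differentiable (fun t : R => t *: u) t.
  exact: differentiableZl.
rewrite deriveD; [|exact: diff_derivable..].
rewrite derive_cst; congr (_ + _).
by rewrite deriveE // diffZl // -deriveE // derive_id scale1r.
Qed.

Lemma line0 p u : line p u 0 = p.
Proof. by rewrite /line scale0r add0r. Qed.

Lemma continuous_line p u : continuous (line p u).
Proof. by move=> t; apply: differentiable_continuous; exact: differentiable_line. Qed.

End Line.

Lemma open_ball0 (R : realType) (e : R) : open [set t : R | `|t| < e].
Proof.
rewrite (_ : [set t | _] = (fun s : R => `|s|) @^-1` [set x | x < e]) //.
by apply: open_comp; [move=> s _; exact: norm_continuous|exact: open_lt].
Qed.

Lemma interval_ball0 (R : realType) (e : R) : is_interval [set t : R | `|t| < e].
Proof.
move=> a b /=; rewrite !ltr_norml => /andP[a1 a2] /andP[b1 b2] z /andP[az zb].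
by rewrite ltr_norml (lt_le_trans a1 az) (le_lt_trans zb b2).
Qed.

Section ParallelTransport.
Variables (R : realType) (n : nat) (M : manifold R n) (D : connection M).
Local Notation J := (@transition_jac R n M).
Variables (c : chart R n M) (p u : 'rV[R]_n).
Hypothesis cc : charts M c.

Definition chart_line t : M := cinv c (line p u t).

Definition cov_frame i : vector_field M :=
  fun y => nabla D (frame M c i) y (const_field M c u y).

(* A field along the line is parallel when its components V in the chart c
   satisfy V' = V *m transport_mx. *)
Definition transport_mx (t : R) : 'M[R]_n :=
  - \matrix_(i < n) vf_rep c (cov_frame i) (line p u t).

Lemma Ck_transport_mx k (I : set R) : open I ->
  (forall t, I t -> (cmap c @` cdom c) (line p u t)) -> Ck k I transport_mx.
Proof.
move=> oI Iim; apply: Ck_mx => // i j.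
have sN := nabla_smooth D (open_cdom cc) (smooth_const_field u cc)
  (smooth_const_field (delta_mx 0 i) cc).
have oc := open_cmap cc (open_cdom cc).
have cN : Ck k (cmap c @` (cdom c `&` cdom c))
  (vf_rep c (cov_frame i)).
  by move/smooth_onP: (sN c cc); exact.
apply: (@Ck_ext _ _ _ _ _ (fun t => (- 1) * ((vf_rep c
    (cov_frame i)) \o line p u) t 0 j)) => //.
  by move=> t It; rewrite [RHS]mxE [X in _ = - X]mxE mulN1r.
apply: CkM => //; first exact: Ck_cst.
apply: (@Ck_coord _ _ _ _ _ _ (vf_rep c (cov_frame i) \o line p u) 0 j oI).
apply: (Ck_comp oI oc _ cN); last exact: Ck_line.
by move=> t /Iim; rewrite setIid.
Qed.

Variables (e : R) (Vc : R -> 'rV[R]_n).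
Local Notation I := [set t : R | `|t| < e].
Hypothesis Iim : forall t, I t -> (cmap c @` cdom c) (line p u t).
Hypothesis dV : forall t : R, I t -> is_derive t 1 Vc (Vc t *m transport_mx t).

Lemma chart_line_dom t : I t -> cdom c (chart_line t).
Proof. by move=> /Iim/(cmap_image cc)[]. Qed.

Lemma cmap_chart_line t : I t -> cmap c (chart_line t) = line p u t.
Proof. by move=> /Iim/(cmap_image cc)[]. Qed.

Lemma continuous_chart_line t : I t -> {for t, continuous chart_line}.
Proof.
move=> It; apply: continuous_comp; first exact: continuous_line.
by apply: cinv_continuous => //; rewrite inE; exact: Iim.
Qed.

Lemma near_chart_line t (U : set M) : I t -> open U -> U (chart_line t) ->
  \forall s \near t, I s /\ U (chart_line s).
Proof.
move=> It oU Ut; apply: (@filterI _ _ _ I (chart_line @^-1` U)).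
  exact: (open_nbhs_nbhs (conj (@open_ball0 R e) It)).
by apply: (continuous_chart_line It); exact: (open_nbhs_nbhs (conj oU Ut)).
Qed.

Lemma chart_line_smooth k m q (d : chart R n M) (f : 'rV[R]_n -> 'M[R]_(m, q)) : charts M d ->
  Ck k (cmap c @` (cdom c `&` cdom d)) f ->
  Ck k (I `&` chart_line @^-1` cdom d) (f \o line p u).
Proof.
move=> cd cf.
have oW : open (I `&` chart_line @^-1` cdom d).
  rewrite openE => t [It dt]; exact: near_chart_line It (open_cdom cd) dt.
apply: (Ck_comp oW (open_cmap cc (open_cdom cd)) _ cf); last exact: Ck_line.
move=> t [It dt]; exists (chart_line t); last exact: cmap_chart_line.
by split => //; exact: chart_line_dom.
Qed.

Lemma smooth_chart_line : smooth_curve I chart_line.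
Proof.
split=> [t|d cd]; first exact: continuous_chart_line.
apply/smooth_onP => k.
apply: (chart_line_smooth (f := cmap d \o cinv c) cd).
by move/smooth_onP: (chart_compat cc cd); exact.
Qed.

Definition transported t := Vc t *m jac_from M c (chart_line t).

Lemma transported_rep (d : chart R n M) t : charts M d -> I t -> cdom d (chart_line t) ->
  transported t *m jac_to M d (chart_line t) =
  Vc t *m jacobian (cmap d \o cinv c) (line p u t).
Proof.
move=> cd It dt; rewrite /transported.
have := const_field_rep (Vc t) cc cd (chart_line_dom It) dt.
rewrite /const_field => ->.
by rewrite /transition_jac (cmap_chart_line It).
Qed.

Lemma smooth_transported : smooth_along I chart_line transported.
Proof.
move=> d cd; apply/smooth_onP => k.
have oW : open (I `&` chart_line @^-1` cdom d).
  rewrite openE => t [It dt]; exact: near_chart_line It (open_cdom cd) dt.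
apply: (@Ck_ext _ _ _ _ _ (fun t => Vc t *m (jacobian (cmap d \o cinv c) \o line p u) t)).
- exact: oW.
- by move=> t [It dt]; rewrite (transported_rep cd It dt).
apply: (Ck_mulmx oW).
  apply: (@Ck_sub _ _ _ _ I); first exact: subIsetl.
  apply: (linear_ode_Ck _ _ _ dV); first exact: open_ball0.
  by move=> j; apply: Ck_transport_mx; [exact: open_ball0|].
apply: (chart_line_smooth cd).
apply: Ck_jacobian; first exact: open_cmap (open_cdom cd).
by move/smooth_onP: (chart_compat cc cd); exact.
Qed.

Lemma velocity_chart_line t : I t ->
  velocity chart_line t = u *m jac_from M c (chart_line t).
Proof.
move=> It; rewrite /velocity derive1E jac_fromE /transition_jac.
set a := chart_at M (chart_line t).
have ca : charts M a := chart_at_charts _; have at_ : cdom a (chart_line t) := chart_at_dom _.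
have dt := differentiable_transition cc ca (chart_line_dom It) at_.
rewrite (cmap_chart_line It) in dt *.
rewrite -(deriveEjacobian _ dt).
apply: etrans (derive_comp (f := cmap a \o cinv c) _ (differentiable_line p u t) dt) _.
by rewrite derive_line.
Qed.

(** The equation for [Vc] lives in [c], but [cov_der] uses the chart [a] preferred at the current
    point. Differentiating Vc J, with J the Jacobian from [c] to [a], creates the extra term Vc (D_u
    J); by [nabla_frame_change] it combines with the Christoffel term of [a] into that of [c], which
    the equation cancels. *)
Lemma parallel_transported : parallel_along D I chart_line transported.
Proof.
split=> [|t It]; first exact: smooth_transported.
rewrite /cov_der derive1E (velocity_chart_line It).
set y := chart_line t; set a := chart_at M y.
have ca : charts M a := chart_at_charts _; have ay : cdom a y := chart_at_dom _.
have cy : cdom c y := chart_line_dom It.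
have oV := open_cmap cc (open_cdom ca).
pose Jca := jacobian (cmap a \o cinv c).
have dJ : differentiable Jca (line p u t).
  apply: (@Ck_differentiable _ 0 _ _ (cmap c @` (cdom c `&` cdom a))).
    by apply: Ck_jacobian => //; move/smooth_onP: (chart_compat cc ca); exact.
  by exists y => //; exact: cmap_chart_line.
have [dVt EV] := dV It.
have dVc : differentiable Vc t by apply/derivable1_diffP.
have dJl := differentiable_comp (differentiable_line p u t) dJ.
have -> : 'D_1 (fun s => transported s *m jac_to M a (chart_line s)) t =
    'D_1 (fun s => Vc s *m (Jca \o line p u) s) t.
  apply: near_eq_derive.
  apply: filterS (near_chart_line It (open_cdom ca) ay) => s [Is as_].
  exact: transported_rep.
rewrite (derive_mulmx _ dVc dJl) EV.
rewrite (derive_comp _ (differentiable_line p u t) dJ) derive_line.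
have JE : Jca (line p u t) = J c a y by rewrite /Jca /transition_jac (cmap_chart_line It).
have fE i : vf_rep c (cov_frame i) (line p u t)
    *m J c a y = nabla D (frame M c i) y (u *m jac_from M c y).
  rewrite /vf_rep -/(chart_line t) -/y -mulmxA -jac_fromE (jac_toK cc cy) mulmx1.
  by [].
have T1 : Vc t *m transport_mx t *m J c a y =
    - \sum_i Vc t 0 i *: nabla D (frame M c i) y (u *m jac_from M c y).
  rewrite /transport_mx mulmxN mulNmx; congr (- _).
  rewrite (mulmx_sum_row (Vc t)) mulmx_suml; apply: eq_bigr => i _.
  by rewrite rowK -scalemxAl fE.
rewrite [(Jca \o line p u) t]/= JE T1.
have T2 : \sum_i Vc t 0 i *: nabla D (frame M c i) y (u *m jac_from M c y) =
    Vc t *m 'D_u Jca (line p u t) +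
    \sum_j transported t 0 j *: nabla D (frame M a j) y (u *m jac_from M c y).
  rewrite (mulmx_sum_row (Vc t)).
  have tE j : transported t 0 j = \sum_i Vc t 0 i * J c a y i j.
    by rewrite /transported jac_fromE -/y -/a [LHS]mxE.
  under [X in _ = _ + X]eq_bigr do rewrite tE scaler_suml.
  rewrite [X in _ = _ + X]exchange_big -big_split /=; apply: eq_bigr => i _.
  apply: etrans (congr1 (fun z => Vc t 0 i *: z) (nabla_frame_change D i u cc cy)) _.
  rewrite -/a (cmap_chart_line It) scalerDr; congr (_ + _).
  by rewrite scaler_sumr; apply: eq_bigr => j _; rewrite scalerA.
have fin (S X Y : 'rV[R]_n) : S = X + Y -> - S + X + Y = 0.
  by move=> ->; rewrite opprD -addrA addrACA !addNr addr0.
exact: (fin _ _ _ T2).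
Qed.

End ParallelTransport.

Section Affine.
Variables (R : realType) (n1 n2 : nat).
Variables (M1 : manifold R n1) (M2 : manifold R n2).
Variables (D1 : connection M1) (D2 : connection M2) (F : M1 -> M2).

Lemma Ck_jacobian_rep k (c : chart R n1 M1) (d : chart R n2 M2) :
  smooth_map F -> charts M1 c -> charts M2 d ->
  Ck k (cmap c @` (cdom c `&` F @^-1` cdom d)) (jacobian (cmap d \o F \o cinv c)).
Proof.
move=> sF cc cd; apply: Ck_jacobian.
  by apply: open_cmap cc _; exact: open_preimage_cdom.
by move/smooth_onP: (sF.2 c d cc cd); exact.
Qed.

(* The second fundamental form of F vanishes: apply the definition of an affine
   map at t = 0 to a parallel field along a line of the chart. *)
Lemma affine_map_second_derivative x u v : affine_map D1 D2 F ->
  v *m 'D_u (jacobian (cmap (chart_at M2 (F x)) \o F \o cinv (chart_at M1 x)))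
         (cmap (chart_at M1 x) x)
  + (u *m dmap M1 M2 F x) *m christoffel D2 (F x, v *m dmap M1 M2 F x) =
  u *m christoffel D1 (x, v) *m dmap M1 M2 F x.
Proof.
move=> [sF affF].
have cc := chart_at_charts x; have cx := chart_at_dom x.
have cd := chart_at_charts (F x); have dx := chart_at_dom (F x).
set c := chart_at M1 x in cc cx *; set d := chart_at M2 (F x) in cd dx *.
set p := cmap c x.
have cp : (cmap c @` cdom c) (line p u 0) by rewrite line0; exists x.
have [e0 e00 He0] : exists2 e0 : R, 0 < e0 & forall t, `|t| < e0 ->
    (cmap c @` cdom c) (line p u t).
  have /nbhs_ballP[e0 /= e00 He0] : \forall t \near (0 : R), (cmap c @` cdom c) (line p u t).
    apply: (@continuous_line _ _ p u 0).
    exact: (open_nbhs_nbhs (conj (open_cimg cc) cp)).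
  exists e0 => // t te; apply: He0.
  by rewrite /ball /= sub0r normrN.
have cA (t : R) : `|t| < e0 -> {for t, continuous (transport_mx D1 c p u)}.
  move=> te; apply: differentiable_continuous.
  exact: (Ck_differentiable (Ck_transport_mx D1 cc 0 (@open_ball0 R e0) He0)).
(* The line has direction u and the field starts at v, so both vectors of the statement are free. *)
have [e [Vc [egt0 ee0 V0 dV]]] := linear_ode v e00 cA.
have Iim t : [set t : R | `|t| < e] t -> (cmap c @` cdom c) (line p u t).
  by move=> te; apply: He0; exact: lt_le_trans te ee0.
have I0 : [set t : R | `|t| < e] 0 by rewrite /= normr0.
have P1 := parallel_transported cc Iim dV.
have [_ P2] := affF _ _ _ (@open_ball0 R e) (@interval_ball0 R e)
  (smooth_chart_line cc Iim) P1.
have {P2} := P2 0 I0.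
have g0 : chart_line c p u 0 = x by rewrite /chart_line line0 /p cmapK_dom.
have oFd := open_preimage_cdom sF cd.
have nF : \forall s \near (0 : R), `|s| < e /\ cdom d (F (chart_line c p u s)).
  apply: (near_chart_line cc Iim I0 oFd).
  by rewrite /preimage /= g0.
set Jf := jacobian (cmap d \o F \o cinv c).
have dJf : differentiable Jf p.
  by apply: (Ck_differentiable (Ck_jacobian_rep 0 sF cc cd)); exists x.
have dJ0 : differentiable Jf (line p u 0) by rewrite line0.
have dJl := differentiable_comp (differentiable_line p u 0) dJ0.
have [dVt EV] := dV 0 I0.
have dVc : differentiable Vc 0 by apply/derivable1_diffP.
have JfE : Jf p = dmap M1 M2 F x by [].
rewrite /cov_der /velocity derive1E [(F \o _) 0]/= g0 -/d derive1E.
have vel : 'D_1 (cmap d \o (F \o chart_line c p u)) 0 = u *m dmap M1 M2 F x.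
  have dr : differentiable (cmap d \o F \o cinv c) (line p u 0).
    by rewrite line0; exact: differentiable_rep.
  apply: etrans (derive_comp (f := cmap d \o F \o cinv c) _ (differentiable_line p u 0) dr) _.
  by rewrite derive_line (deriveEjacobian _ dr) line0.
rewrite vel.
have T0 : transported c p u Vc 0 = v.
  by rewrite /transported g0 jac_from_id mulmx1.
rewrite T0.
(* In the fixed chart [d] the image field is [Vc] times the Jacobian of [F] along the line; the
   product rule then produces the second derivative of [F]. *)
have -> : 'D_1 (fun s => transported c p u Vc s *m dmap M1 M2 F (chart_line c p u s) *m
      jac_to M2 d ((F \o chart_line c p u) s)) 0 =
    'D_1 (fun s => Vc s *m (Jf \o line p u) s) 0.
  apply: near_eq_derive; apply: filterS nF => s [Is ds].
  have cs := chart_line_dom cc Iim Is.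
  rewrite [(Jf \o _) s]/= -(cmap_chart_line cc Iim Is).
  by rewrite /Jf (jacobian_rep sF cc cd cs ds) !mulmxA.
rewrite (derive_mulmx _ dVc dJl) EV.
rewrite (derive_comp _ (differentiable_line p u 0) dJ0) derive_line.
rewrite [(Jf \o _) 0]/= line0 JfE V0.
rewrite mul_christoffel mul_christoffel -/c -/d.
have tE : v *m transport_mx D1 c p u 0 =
    - \sum_j v 0 j *: nabla D1 (frame M1 c j) x u.
  rewrite /transport_mx mulmxN; congr (- _).
  rewrite mulmx_sum_row; apply: eq_bigr => i _.
  rewrite rowK /vf_rep -/(chart_line c p u 0) g0 jac_to_id mulmx1.
  by rewrite /cov_frame /const_field jac_from_id mulmx1.
rewrite tE mulNmx.
have fin (S X Y : 'rV[R]_n2) : - S + X + Y = 0 -> X + Y = S.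
  by move=> /eqP; rewrite -addrA addrC subr_eq0 => /eqP.
exact: fin.
Qed.

End Affine.

(** * The tangent bundle *)

Lemma Ck_row_mx (R : realType) (V : normedModType R) k m n1 n2 (U : set V)
    (f : V -> 'M[R]_(m, n1)) (g : V -> 'M[R]_(m, n2)) : open U ->
  Ck k U f -> Ck k U g -> Ck k U (fun x => row_mx (f x) (g x)).
Proof.
move=> oU cf cg; apply: (Ck_mx oU) => i j; case: (split_ordP j) => l ->.
  by under eq_fun do rewrite row_mxEl; exact: Ck_coord.
by under eq_fun do rewrite row_mxEr; exact: Ck_coord.
Qed.

Lemma open_lsubmx (R : realType) n (U : set 'rV[R]_n) : open U ->
  open ((lsubmx : 'rV[R]_(n + n) -> 'rV[R]_n) @^-1` U).
Proof.
move=> oU; apply: open_comp oU => q _.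
apply: differentiable_continuous.
exact: (Ck_differentiable (Ck_lsubmx 0 openT)).
Qed.

Section TangentCharts.
Variables (R : realType) (n : nat) (M : manifold R n).
Local Notation TA := (tangent_atlas M).

Lemma tangent_chartK (c : chart R n M) (w : M * 'rV[R]_n) : charts M c -> cdom c w.1 ->
  cinv (tangent_chart M c) (cmap (tangent_chart M c) w) = w.
Proof.
case: w => x v /= cc cx; rewrite row_mxKl row_mxKr (cmapK_dom cc cx).
by rewrite -mulmxA (jac_toK cc cx) mulmx1.
Qed.

(** The image of a tangent chart lies in the cylinder over the image of the base chart, an explicit
    open set to which the [Ck] lemmas apply. *)
Lemma smooth_fun_tangent (f : M * 'rV[R]_n -> R) :
  (forall c k, charts M c -> Ck k (lsubmx @^-1` (cmap c @` cdom c))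
     (f \o cinv (tangent_chart M c))) -> smooth_fun TA setT f.
Proof.
move=> H _ [c cc <-]; apply/smooth_onP => k; apply: Ck_sub (H c k cc).
by move=> _ [[x v] [/= cx _] <-] /=; rewrite row_mxKl; exists x.
Qed.

Lemma differential_tangent (f : M * 'rV[R]_n -> R) w (a : 'cV[R]_(n + n)) :
  let c := tangent_chart M (chart_at M w.1) in
  (forall U, 'D_U (f \o cinv c) (cmap c w) = (U *m a) 0 0) ->
  differential TA f w = a.
Proof.
by move=> c H; apply/colP => i; rewrite mxE /dirder H -rowE mxE.
Qed.

Lemma cmap_tangent0 x : cmap (tangent_chart M (chart_at M x)) (x, 0) =
  row_mx (cmap (chart_at M x) x) 0.
Proof. by rewrite /= mul0mx. Qed.

Lemma smooth_fun_base (f : M -> R) : smooth_fun M setT f ->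
  smooth_fun TA setT (f \o fst).
Proof.
move=> sf; apply: smooth_fun_tangent => c k cc.
have oU := open_lsubmx (open_cimg cc).
apply: (@Ck_comp_real _ _ _ _ _ (cmap c @` (cdom c `&` setT)) (f \o cinv c)) => //.
- by move=> q; rewrite setIT.
- by move/smooth_onP: (sf c cc); exact.
- exact: Ck_lsubmx.
Qed.

Lemma differential_base (f : M -> R) x : smooth_fun M setT f ->
  differential TA (f \o fst) (x, 0) = col_mx (differential M f x) 0.
Proof.
move=> sf; apply: differential_tangent => U; rewrite cmap_tangent0 /=.
have cc := chart_at_charts x; have cx := chart_at_dom x.
set c := chart_at M x in cc cx *.
have dl : differentiable (lsubmx : 'rV[R]_(n + n) -> 'rV[R]_n) (row_mx (cmap c x) 0).
  exact: (Ck_differentiable (Ck_lsubmx 0 openT)).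
have df : differentiable (f \o cinv c) (lsubmx (row_mx (cmap c x) 0 : 'rV[R]_(n + n))).
  by rewrite row_mxKl; apply: (sf c cc [::]); exists x.
apply: etrans (derive_comp (f := f \o cinv c) U dl df) _.
rewrite derive_lsubmx row_mxKl (derive_in_chart _ cc cx openT I sf).
rewrite jac_from_id mulmx1 -[U in RHS]hsubmxK.
by rewrite mul_row_col mulmx0 addr0.
Qed.

Definition fiber_linear (a : one_form M) (w : M * 'rV[R]_n) : R := (w.2 *m a w.1) 0 0.

Lemma fiber_linear_rep (c : chart R n M) (a : one_form M) q :
  (fiber_linear a \o cinv (tangent_chart M c)) q =
  (rsubmx q *m form_rep c a (lsubmx q)) 0 0.
Proof. by rewrite /fiber_linear /form_rep /= mulmxA. Qed.

Lemma smooth_fiber_linear (a : one_form M) : smooth_form M setT a ->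
  smooth_fun TA setT (fiber_linear a).
Proof.
move=> sa; apply: smooth_fun_tangent => c k cc.
have oU := open_lsubmx (open_cimg cc).
have oV := open_cmap cc openT.
apply: (@Ck_ext _ _ _ _ _ (fun q => (rsubmx q *m (form_rep c a \o lsubmx) q) 0 0)) => //.
  by move=> q _; rewrite fiber_linear_rep.
apply: (@Ck_coord _ _ _ _ _ _ (fun q => rsubmx q *m (form_rep c a \o lsubmx) q) 0 0 oU).
apply: (Ck_mulmx oU); first exact: Ck_rsubmx.
apply: (@Ck_comp _ _ _ _ _ _ _ (cmap c @` (cdom c `&` setT))) => //.
- by move=> q; rewrite setIT.
- by move/smooth_onP: (sa c cc); exact.
- exact: Ck_lsubmx.
Qed.

(** The derivative of [a] enters only with the fibre coordinate as a factor, which is 0 on the zero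
    section. *)
Lemma differential_fiber_linear (a : one_form M) x : smooth_form M setT a ->
  differential TA (fiber_linear a) (x, 0) = col_mx 0 (a x).
Proof.
move=> sa; apply: differential_tangent => U; rewrite cmap_tangent0 /=.
have cc := chart_at_charts x; have cx := chart_at_dom x.
set c := chart_at M x in cc cx *.
pose Q : 'rV[R]_(n + n) := row_mx (cmap c x) 0.
rewrite -/Q.
have dl : differentiable (lsubmx : 'rV[R]_(n + n) -> 'rV[R]_n) Q.
  exact: (Ck_differentiable (Ck_lsubmx 0 openT)).
have dr : differentiable (rsubmx : 'rV[R]_(n + n) -> 'rV[R]_n) Q.
  exact: (Ck_differentiable (Ck_rsubmx 0 openT)).
have da : differentiable (form_rep c a) (lsubmx Q).
  by rewrite /Q row_mxKl; apply: (sa c cc [::]); exists x.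
have dal := differentiable_comp dl da.
pose g (q : 'rV[R]_(n + n)) := rsubmx q *m (form_rep c a \o lsubmx) q.
have dg : differentiable g Q.
  have oU := open_lsubmx (open_cimg cc).
  have oV := open_cmap cc openT.
  have cg : Ck 0 (lsubmx @^-1` (cmap c @` cdom c)) g.
    apply: (Ck_mulmx oU); first exact: Ck_rsubmx.
    apply: (@Ck_comp _ _ _ _ _ _ _ (cmap c @` (cdom c `&` setT))) => //.
    - by move=> q; rewrite setIT.
    - by move/smooth_onP: (sa c cc); exact.
    - exact: Ck_lsubmx.
  by apply: (Ck_differentiable cg); rewrite /preimage /= row_mxKl; exists x.
have -> : fiber_linear a \o cinv (tangent_chart M c) = (fun q => g q 0 0).
  by apply/funext => q; rewrite fiber_linear_rep.
rewrite (derive_coord _ _ _ dg) (derive_mulmx _ dr dal) derive_rsubmx.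
rewrite [X in _ + X *m _]row_mxKr mul0mx addr0 [(_ \o _) Q]/= row_mxKl.
rewrite /form_rep (cmapK_dom cc cx) jac_from_id mul1mx.
by rewrite -[U in RHS]hsubmxK mul_row_col mulmx0 add0r.
Qed.

End TangentCharts.

Section TangentMap.
Variables (R : realType) (n1 n2 : nat).
Variables (M1 : manifold R n1) (M2 : manifold R n2) (F : M1 -> M2).
Hypothesis sF : smooth_map F.
Local Notation TF := (tangent_map M1 M2 F).
Local Notation TA1 := (tangent_atlas M1).
Local Notation TA2 := (tangent_atlas M2).

Section AtPoint.
Variables (x : M1) (v : 'rV[R]_n1).
Let c := chart_at M1 x.
Let d := chart_at M2 (F x).
Let rep := cmap d \o F \o cinv c.
Let Jf := jacobian rep.
Let Q := cmap (tangent_chart M1 c) (x, v).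
Let G (q : 'rV[R]_(n1 + n1)) := row_mx ((rep \o lsubmx) q) (rsubmx q *m (Jf \o lsubmx) q).
Let U := (lsubmx : 'rV[R]_(n1 + n1) -> _) @^-1` (cmap c @` (cdom c `&` F @^-1` cdom d)).

Let cc : charts M1 c. Proof. exact: chart_at_charts. Qed.
Let cd : charts M2 d. Proof. exact: chart_at_charts. Qed.
Let cx : cdom c x. Proof. exact: chart_at_dom. Qed.
Let dx : cdom d (F x). Proof. exact: chart_at_dom. Qed.

Let oV : open (cmap c @` (cdom c `&` F @^-1` cdom d)).
Proof. by apply: open_cmap cc _; exact: open_preimage_cdom. Qed.

Let oU : open U. Proof. exact: open_lsubmx. Qed.

Let QE : Q = row_mx (cmap c x) v.
Proof. by rewrite /Q /= jac_to_id mulmx1. Qed.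

Let UQ : U Q. Proof. by rewrite /U /preimage /= row_mxKl; exists x. Qed.

Lemma tangent_rep q : U q ->
  (cmap (tangent_chart M2 d) \o TF \o cinv (tangent_chart M1 c)) q = G q.
Proof.
move=> [y [cy dy] yq]; rewrite /= -yq (cmapK_dom cc cy).
congr row_mx; first by rewrite /rep /= -yq (cmapK_dom cc cy).
rewrite [(Jf \o lsubmx) q]/= -yq /Jf /rep (jacobian_rep sF cc cd cy dy).
by rewrite !mulmxA.
Qed.

Let Ck_rep k : Ck k (cmap c @` (cdom c `&` F @^-1` cdom d)) rep.
Proof. by move/smooth_onP: (sF.2 c d cc cd); exact. Qed.

Let Ck_rep_l k : Ck k U (rep \o lsubmx).
Proof. by apply: (Ck_comp oU oV _ (Ck_rep k)) => //; exact: Ck_lsubmx. Qed.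

Let Ck_Jf_l k : Ck k U (Jf \o lsubmx).
Proof. by apply: (Ck_comp oU oV _ (Ck_jacobian_rep k sF cc cd)) => //; exact: Ck_lsubmx. Qed.

Lemma Ck_G k : Ck k U G.
Proof.
apply: (Ck_row_mx oU (Ck_rep_l k)); apply: (Ck_mulmx oU _ (Ck_Jf_l k)).
exact: Ck_rsubmx.
Qed.

Lemma differentiable_tangent_rep : differentiable
  (cmap (tangent_chart M2 d) \o TF \o cinv (tangent_chart M1 c)) Q.
Proof.
apply: (near_eq_differentiable (f := G)).
  by apply: filterS (open_nbhs_nbhs (conj oU UQ)) => q Uq; rewrite tangent_rep.
exact: (Ck_differentiable (Ck_G 0) UQ).
Qed.

(** In charts the tangent map is (p, v) |-> (rep p, v Jf(p)). The second derivative of [F] enters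
    through the base component of u alone. *)
Lemma mul_dmap_tangent u :
  u *m dmap TA1 TA2 TF (x, v) =
  row_mx (lsubmx u *m dmap M1 M2 F x)
    (rsubmx u *m dmap M1 M2 F x + v *m 'D_(lsubmx u) Jf (cmap c x)).
Proof.
have JE : Jf (cmap c x) = dmap M1 M2 F x by [].
apply: etrans (esym (deriveEjacobian u differentiable_tangent_rep)) _.
apply: etrans (_ : 'D_u G Q = _).
  apply: near_eq_derive.
  by apply: filterS (open_nbhs_nbhs (conj oU UQ)) => q; exact: tangent_rep.
have d1 := Ck_differentiable (Ck_rep_l 0) UQ.
have d2 := Ck_differentiable (Ck_Jf_l 0) UQ.
have dl : differentiable (lsubmx : 'rV[R]_(n1 + n1) -> 'rV[R]_n1) Q.
  exact: (Ck_differentiable (Ck_lsubmx 0 openT)).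
have dr : differentiable (rsubmx : 'rV[R]_(n1 + n1) -> 'rV[R]_n1) Q.
  exact: (Ck_differentiable (Ck_rsubmx 0 openT)).
have lQ : lsubmx Q = cmap c x by rewrite QE row_mxKl.
have rQ : rsubmx Q = v by rewrite QE row_mxKr.
have dm : differentiable (fun q => rsubmx q *m (Jf \o lsubmx) q) Q.
  apply: (Ck_differentiable _ UQ (k := 0)).
  by apply: (Ck_mulmx oU _ (Ck_Jf_l 0)); exact: Ck_rsubmx.
have drep : differentiable rep (lsubmx Q).
  by rewrite lQ; exact: differentiable_rep.
have dJ : differentiable Jf (lsubmx Q).
  by rewrite lQ; apply: (Ck_differentiable (Ck_jacobian_rep 0 sF cc cd)); exists x.
rewrite (derive_row_mx _ d1 dm) (derive_mulmx _ dr d2).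
rewrite (derive_comp _ dl drep) (derive_comp _ dl dJ) derive_lsubmx derive_rsubmx.
rewrite (deriveEjacobian _ drep) [(Jf \o lsubmx) Q]/= lQ rQ.
by [].
Qed.

End AtPoint.

Lemma differential_tangent_map (f : M2 * 'rV[R]_n2 -> R) w :
  smooth_fun TA2 setT f ->
  differential TA1 (f \o TF) w = dmap TA1 TA2 TF w *m differential TA2 f (TF w).
Proof.
case: w => x v sf.
have cc := chart_at_charts x; have cx := chart_at_dom x.
have cd := chart_at_charts (F x); have dx := chart_at_dom (F x).
apply: differential_comp.
- exact: tangent_chartK.
- exact: differentiable_tangent_rep.
- apply: (sf (tangent_chart M2 (chart_at M2 (F x))) _ [::]); first by exists (chart_at M2 (F x)).
  by exists (TF (x, v)).
- have oV := open_cmap cc (open_preimage_cdom sF cd).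
  have := open_nbhs_nbhs (conj (open_lsubmx oV) _).
  move=> /(_ (cmap (tangent_chart M1 (chart_at M1 x)) (x, v))) H.
  apply: filterS (H _); last by rewrite /preimage /= row_mxKl; exists x.
  move=> q [y [cy dy] yq]; apply: tangent_chartK => //.
  by rewrite /= -yq (cmapK_dom cc cy).
Qed.

End TangentMap.

Section Bilinear.
Variable R : realType.

Lemma bival_mul m n (h : 'M[R]_m) (A : 'M[R]_(m, n)) (a b : 'cV[R]_n) :
  bival h (A *m a) (A *m b) = bival (A^T *m h *m A) a b.
Proof. by rewrite /bival trmx_mul !mulmxA. Qed.

Lemma bival_ext n (h k : 'M[R]_n) :
  (forall a b, bival h a b = bival k a b) -> h = k.
Proof.
move=> H; apply/matrixP => i j.
have := H (delta_mx i 0) (delta_mx j 0).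
by rewrite /bival !trmx_delta -!rowE -!colE !mxE.
Qed.

Lemma bival0l n (h : 'M[R]_n) b : bival h 0 b = 0.
Proof. by rewrite /bival trmx0 !mul0mx mxE. Qed.

End Bilinear.

Section Lifts.
Variables (R : realType) (n : nat) (M : manifold R n) (D : connection M).

Lemma bival_assoc_bivector (h : bivector_field M) w a b :
  bival (assoc_bivector D h w) a b =
  bival (h w.1) (hlift D w *m a) (vlift _ _ *m b)
  - bival (h w.1) (hlift D w *m b) (vlift _ _ *m a).
Proof.
have skewE (K : 'M[R]_(n + n)) : a^T *m (K - K^T) *m b = a^T *m K *m b - (b^T *m K *m a)^T.
  by rewrite !trmx_mul trmxK mulmxBr mulmxBl !mulmxA.
have subE (X Y : 'M[R]_1) : (X - Y^T) 0 0 = X 0 0 - Y 0 0 by rewrite !mxE.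
by rewrite /bival /assoc_bivector skewE subE !trmx_mul !mulmxA.
Qed.

Lemma christoffel0 x : christoffel D (x, 0) = 0.
Proof. by rewrite /christoffel big1 // => j _; rewrite mxE scale0r. Qed.

End Lifts.

(** * Reduction of the four assertions to one pointwise identity *)

Section Equivalences.
Variables (R : realType) (n1 n2 : nat).
Variables (M1 : manifold R n1) (M2 : manifold R n2).
Variables (D1 : connection M1) (D2 : connection M2).
Variables (h1 : bivector_field M1) (h2 : bivector_field M2) (F : M1 -> M2).
Hypothesis affF : affine_map D1 D2 F.
Let sF : smooth_map F := affF.1.
Local Notation TF := (tangent_map M1 M2 F).
Local Notation A := (dmap M1 M2 F).

Definition pushes x := (A x)^T *m h1 x *m A x = h2 (F x).

(** A vertical vector has base component 0, which removes the second derivative from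
    [mul_dmap_tangent]. *)
Lemma vlift_dmap w :
  vlift R n1 *m dmap (tangent_atlas M1) (tangent_atlas M2) TF w = A w.1 *m vlift R n2.
Proof.
case: w => x v /=; apply/row_matrixP => i; rewrite !rowE !mulmxA.
rewrite (mul_dmap_tangent sF) /vlift !mul_mx_row !mulmx0 !mulmx1.
rewrite row_mxKl row_mxKr mul0mx derive0.
by rewrite mulmx0 addr0.
Qed.

(** The second derivative of [F] turns the image of the correction [- christoffel D1] into that of
    [D2], by [affine_map_second_derivative]. *)
Lemma hlift_dmap w :
  hlift D1 w *m dmap (tangent_atlas M1) (tangent_atlas M2) TF w =
  A w.1 *m hlift D2 (TF w).
Proof.
case: w => x v; apply/row_matrixP => i; rewrite !rowE !mulmxA.
rewrite (mul_dmap_tangent sF) /hlift !mul_mx_row !mulmx1.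
rewrite row_mxKl row_mxKr; congr row_mx.
have := affine_map_second_derivative x (delta_mx 0 i) v affF.
rewrite /tangent_map /=.
move: (v *m 'D_ _ _ _) => S H.
rewrite !mulmxN mulNmx -H opprD.
by rewrite addrAC addNr add0r.
Qed.

(** The right-hand side is the bracket of f and g for [D2] with A^T h1 A in place of h2; both
    directions of the Poisson equivalence compare it with h2. *)
Lemma bracket_tangent_map f g w :
  smooth_fun (tangent_atlas M2) setT f -> smooth_fun (tangent_atlas M2) setT g ->
  bracket (assoc_bivector D1 h1) (f \o TF) (g \o TF) w =
  let a := differential (tangent_atlas M2) f (TF w) in
  let b := differential (tangent_atlas M2) g (TF w) in
  let k := (A w.1)^T *m h1 w.1 *m A w.1 in
  bival k (hlift D2 (TF w) *m a) (vlift R n2 *m b)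
  - bival k (hlift D2 (TF w) *m b) (vlift R n2 *m a).
Proof.
move=> sf sg; rewrite /bracket.
rewrite (differential_tangent_map sF w sf) (differential_tangent_map sF w sg).
rewrite bival_assoc_bivector !mulmxA vlift_dmap hlift_dmap -!mulmxA.
by rewrite !bival_mul !mulmxA.
Qed.

Lemma kv_map_pushes : kv_map F h1 h2 <-> forall x, pushes x.
Proof.
split=> [kvF x|HF a b sa sb x]; last by rewrite /pullback bival_mul HF.
apply: bival_ext => a b.
have [f sf <-] := exists_differential (F x) a.
have [g sg <-] := exists_differential (F x) b.
rewrite -bival_mul.
exact: kvF (smooth_form_differential sf) (smooth_form_differential sg) x.
Qed.

Lemma poisson_map_pushes :
  poisson_map TF (assoc_bivector D1 h1) (assoc_bivector D2 h2) <-> forall x, pushes x.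
Proof.
split=> [PF x|HF f g sf sg w]; last first.
  by rewrite bracket_tangent_map //= HF /bracket bival_assoc_bivector.
apply: bival_ext => a b.
have [f sf fE] := exists_differential (F x) a.
have [g sg gE] := exists_differential (F x) b.
have sdg := smooth_form_differential sg.
have := PF _ _ (smooth_fun_base sf) (smooth_fiber_linear sdg) (x, 0).
rewrite bracket_tangent_map; [|exact: smooth_fun_base|exact: smooth_fiber_linear].
rewrite /bracket bival_assoc_bivector /tangent_map /= mul0mx.
rewrite (differential_base _ sf) (differential_fiber_linear _ sdg) fE gE.
(* At the zero vector the horizontal lift of u is (u, 0). The two differentials (a, 0) and (0, b)
   are thus purely horizontal and purely vertical: the first term is the bilinear form at a, b and
   the second vanishes. *)
rewrite /hlift /vlift christoffel0 oppr0 !mul_row_col !mul0mx !mul1mx.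
by rewrite !(addr0, add0r) !bival0l !subr0.
Qed.

(** [F]-relatedness equates vectors, so only the first covector has to be realized by a global form;
    pairing with b is free. *)
Lemma related_sharp_pushes :
  (forall a : one_form M2, smooth_form M2 setT a ->
     F_related F (sharp h1 (pullback M1 F a)) (sharp h2 a)) <->
  forall x, pushes x.
Proof.
split=> [HF x|HF a sa x]; last first.
  by rewrite /sharp /pullback trmx_mul -HF !mulmxA.
apply: bival_ext => a b.
have [f sf <-] := exists_differential (F x) a.
have := HF _ (smooth_form_differential sf) x.
by rewrite /bival /sharp /pullback trmx_mul !mulmxA => ->.
Qed.

(** As d(f o F) is the pullback of df, this is the previous assertion for exact forms, and these
    already take every value at a given point. *)
Lemma related_hamiltonian_pushes :
  (forall f : M2 -> R, smooth_fun M2 setT f ->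
     F_related F (hamiltonian h1 (f \o F)) (hamiltonian h2 f)) <->
  forall x, pushes x.
Proof.
split=> [HF x|HF f sf x]; last first.
  rewrite /hamiltonian /sharp (differential_pullback sF x sf) trmx_mul -HF.
  by rewrite !mulmxA.
apply: bival_ext => a b.
have [f sf <-] := exists_differential (F x) a.
have := HF _ sf x.
rewrite /hamiltonian /sharp (differential_pullback sF x sf) trmx_mul.
by rewrite /bival !mulmxA => ->.
Qed.

End Equivalences.

Theorem theorem4p1 (R : realType) (n1 n2 : nat)
    (M1 : manifold R n1) (M2 : manifold R n2)
    (D1 : connection M1) (D2 : connection M2)
    (h1 : bivector_field M1) (h2 : bivector_field M2)
    (kv1 : kv_manifold D1 h1) (kv2 : kv_manifold D2 h2)
    (F : M1 -> M2) (affF : affine_map D1 D2 F) :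
  [<-> kv_map F h1 h2;
       poisson_map (tangent_map M1 M2 F)
         (assoc_bivector D1 h1) (assoc_bivector D2 h2);
       forall a : one_form M2, smooth_form M2 setT a ->
         F_related F (sharp h1 (pullback M1 F a)) (sharp h2 a);
       forall f : M2 -> R, smooth_fun M2 setT f ->
         F_related F (hamiltonian h1 (f \o F)) (hamiltonian h2 f)].
Proof.
have E1 := kv_map_pushes h1 h2 F.
have E2 := poisson_map_pushes h1 h2 affF.
have E3 := related_sharp_pushes h1 h2 F.
have E4 := related_hamiltonian_pushes h1 h2 affF.
tfae.
- by move=> /E1/E2.
- by move=> /E2/E3.
- by move=> /E3/E4.
- by move=> /E4/E1.
Qed.
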